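(* Let $p,q\in\mathbb Z^3$ with $\sum p_i=\sum q_i$ and $p-q_\sigma\neq 0$ for all $\sigma\in S_3$, so that the Eschenburg orbifold $E_{p,q}$ is defined, and let $a,b\in\mathbb Z^3$ with $\sum a_i=\sum b_i$. The circle action $\mathrm S^1_{a,b}$ on $E_{p,q}$ is almost free (all isotropy groups are finite) if and only if for every $\sigma\in S_3$ the vectors $p-q_\sigma$ and $a-b_\sigma$ are linearly independent. In this case the quotient $O^{a,b}_{p,q}=E_{p,q}/\mathrm S^1_{a,b}$ is an orbifold whose singular locus is the union of at most nine orbifold 2-spheres and six points, arranged according to the following incidence diagram: the possible singular points are the images $\hat\pi(C_\sigma)$, $\sigma\in S_3$; the possible singular orbifold 2-spheres are the images $\hat\pi(\mathcal L_{ij})$, $1\le i,j\le 3$; and $\hat\pi(\mathcal L_{ij})$ joins precisely the two points $\hat\pi(C_\sigma)$, $\hat\pi(C_{\sigma'})$ for which $\sigma(i)=\sigma'(i)=j$ (so the diagram is the graph with six vertices indexed by $S_3$ and nine edges indexed by pairs $(i,j)$).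
   Context: For $z\in\mathrm S^1=\{z\in\mathbb C:|z|=1\}$ and $p\in\mathbb Z^3$ put $z^p=\mathrm{diag}(z^{p_1},z^{p_2},z^{p_3})\in \mathrm U(3)$; for $q\in\mathbb Z^3$ and $\sigma\in S_3$ put $q_\sigma=(q_{\sigma(1)},q_{\sigma(2)},q_{\sigma(3)})$. For $p,q\in\mathbb Z^3$ with $\sum p_i=\sum q_i$, the circle acts on $\mathrm{SU}(3)$ by $z\cdot g=z^p g\,\bar z^{\,q}$; this action is almost free iff $p-q_\sigma\ne0$ for all $\sigma\in S_3$, and then the quotient is the 7-dimensional Eschenburg orbifold $E_{p,q}$, with projection $\pi:\mathrm{SU}(3)\to E_{p,q}$. For $a,b\in\mathbb Z^3$ with $\sum a_i=\sum b_i$, the circle action $\mathrm S^1_{a,b}$ on $E_{p,q}$ is $w\cdot[g]=[w^a g\,\bar w^{\,b}]$, $w\in \mathrm S^1$; its quotient is $O^{a,b}_{p,q}$ with projection $\hat\pi:E_{p,q}\to O^{a,b}_{p,q}$; equivalently $O^{a,b}_{p,q}$ is the quotient of $\mathrm{SU}(3)$ by the $\mathrm T^2$-action $(z,w)\cdot g=w^az^pg\bar z^{\,q}\bar w^{\,b}$. When a compact Lie group acts almost freely on a manifold, the quotient is an orbifold whose orbifold groups are the isotropy groups divided by the ineffective kernel; the singular locus is the set of points with non-trivial orbifold group. For $1\le i,j\le3$, $\mathrm U(2)_{ij}\subset\mathrm{SU}(3)$ is the set of $g\in \mathrm{SU}(3)$ whose only nonzero entry in row $i$ and in column $j$ is the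 $(i,j)$ entry (a copy of $\mathrm U(2)$). For $\sigma\in S_3$, $\mathrm T^2_\sigma\subset\mathrm{SU}(3)$ is the set of $g\in\mathrm{SU}(3)$ whose nonzero entries are exactly those in positions $(i,\sigma(i))$, $i=1,2,3$. Put $\mathcal L_{ij}=\pi(\mathrm U(2)_{ij})$ and $C_\sigma=\pi(\mathrm T^2_\sigma)$. An orbifold 2-sphere is a 2-dimensional orbifold homeomorphic to $\mathbb S^2$. The phrase ''union of at most'' these spheres and points means: the singular locus is $\bigcup_{(i,j)\in\Gamma}\hat\pi(\mathcal L_{ij})\cup\bigcup_{\sigma\in\Sigma}\hat\pi(C_\sigma)$ for some (possibly empty) subsets $\Gamma\subset\{1,2,3\}^2$ and $\Sigma\subset S_3$. *)

(* Defs.v *)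
From HB Require Import structures.
From mathcomp Require Export all_boot all_order all_algebra perm.
From mathcomp Require Export all_classical all_reals all_analysis.
From mathcomp.real_closed Require Export complex.
Export Order.TTheory GRing.Theory Num.Theory numFieldNormedType.Exports.

Set Implicit Arguments.
Unset Strict Implicit.
Unset Printing Implicit Defensive.

Local Open Scope classical_set_scope.
Local Open Scope quotient_scope.
Local Open Scope ring_scope.

Section Smooth.
Variable R : realType.

(* C^k through iterated directional derivatives; on a finite-dimensional
   domain this is the usual class C^k. *)
Fixpoint Ck (V W : normedModType R) (k : nat) (f : V -> W) : Prop :=
  match k with
  | 0%N => continuous f
  | k'.+1 => forall v : V,
      (forall x, derivable f x v) /\ @Ck V W k' (fun x => 'D_v f x)
  end.

Definition smooth (V W : normedModType R) (f : V -> W) : Prop :=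
  forall k, @Ck V W k f.

(* [M] is a smooth embedded d-dimensional submanifold of R^N: around each of
   its points it is the regular zero set of N - d smooth functions. *)
Definition submanifold (N d : nat) (M : set 'rV[R]_N) : Prop :=
  (d <= N)%N /\
  forall x, M x ->
    exists F : 'rV[R]_N -> 'rV[R]_(N - d),
      [/\ smooth F,
          forall u, exists v, 'D_v F x = u
        & \forall y \near x, M y <-> F y = 0].

End Smooth.

Definition homeomorphic (T U : topologicalType) (A : set T) (B : set U) : Prop :=
  exists (f : T -> U) (g : U -> T),
    [/\ {within A, continuous f}, {within B, continuous g},
        forall x, A x -> B (f x) /\ g (f x) = x
      & forall y, B y -> A (g y) /\ f (g y) = y].

Definition sphere2 (R : realType) : set 'rV[R]_3 :=
  [set v | \sum_i v 0 i ^+ 2 = 1].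

Arguments sphere2 R : clear implicits.

Section SU3.
Variable R : realType.
Local Notation C := R[i].

Definition unit_circle : set C := [set z | `|z| = 1].
Definition S1 : Type := set_type unit_circle.

Definition su3_set : set 'M[C]_3 := [set g | g \is unitarymx /\ \det g = 1].

Definition real_coords (g : 'M[C]_3) : 'rV[R]_(3 * 3 + 3 * 3) :=
  row_mx (mxvec (map_mx (@complex.Re R) g)) (mxvec (map_mx (@complex.Im R) g)).

(* SU(3) with the topology inherited from 'M[C]_3 = R^18. *)
Definition SU3 : Type :=
  initial_topology (fun g : set_type su3_set => real_coords (val g)).
HB.instance Definition _ := Topological.on SU3.

Definition SU3mx (g : SU3) : 'M[C]_3 := val (g : set_type su3_set).

(* z^p *)
Definition zdiag (z : C) (p : 'rV[int]_3) : 'M[C]_3 :=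
  diag_mx (\row_i z ^ p 0 i).

Lemma S1_norm (z : S1) : `|val z| = 1.
Proof. by case: z => z /= /set_mem. Qed.

Lemma S1_neq0 (z : S1) : val z != 0.
Proof. by rewrite -normr_eq0 S1_norm oner_eq0. Qed.

Lemma S1_mulC (z : S1) : val z * (val z)^* = 1.
Proof. by rewrite -normCK S1_norm expr1n. Qed.

Lemma S1_conj_neq0 (z : S1) : (val z)^* != 0.
Proof. by rewrite conjC_eq0 S1_neq0. Qed.

Lemma S1_mem (z : C) : `|z| = 1 -> z \in unit_circle.
Proof. by move=> h; exact: mem_set. Qed.

Definition S1_one : S1 := SigSub (S1_mem (normr1 C)).
Definition S1_mul (z w : S1) : S1 :=
  SigSub (S1_mem (etrans (normrM (val z) (val w))
    (etrans (congr2 *%R (S1_norm z) (S1_norm w)) (mulr1 1)))).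
Definition S1_conj (z : S1) : S1 :=
  SigSub (S1_mem (etrans (norm_conjC (val z)) (S1_norm z))).

Lemma zdiag1 p : zdiag 1 p = 1%:M.
Proof. by apply/matrixP=> i j; rewrite !mxE exp1rz. Qed.

Lemma zdiagM (z w : C) p : zdiag (z * w) p = zdiag z p *m zdiag w p.
Proof.
rewrite /zdiag mulmx_diag; congr diag_mx; apply/rowP=> i; rewrite !mxE.
by rewrite expfzMl.
Qed.

Lemma zdiagC (z w : C) p q : zdiag z p *m zdiag w q = zdiag w q *m zdiag z p.
Proof.
by rewrite /zdiag !mulmx_diag; congr diag_mx; apply/rowP=> i; rewrite !mxE mulrC.
Qed.

Lemma zdiag_conj (z : C) p : (zdiag z p)^t*%sesqui = zdiag z^* p.
Proof.
apply/matrixP=> i j; rewrite !mxE eq_sym.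
by case: eqP => [->|_]; rewrite ?mulr1n ?mulr0n ?rmorph0 // fmorphXz.
Qed.

Lemma zdiag_unitary (z : S1) p : zdiag (val z) p \is unitarymx.
Proof. by apply/unitarymxP; rewrite zdiag_conj -zdiagM S1_mulC zdiag1. Qed.

Lemma det_zdiag (z : C) p : z != 0 -> \det (zdiag z p) = z ^ (\sum_i p 0 i).
Proof.
move=> z0; have zD : {morph (fun n : int => z ^ n) : m n / m + n >-> m * n}.
  by move=> m n; rewrite expfzDr.
rewrite det_diag (big_morph _ zD (expr0z z)).
by apply: eq_bigr => i _; rewrite mxE.
Qed.

Section Action.
Variables (p q : 'rV[int]_3) (hpq : \sum_i p 0 i = \sum_i q 0 i).

(* z^p g zbar^q *)
Definition act_mx (z : C) (g : 'M[C]_3) : 'M[C]_3 :=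
  zdiag z p *m g *m zdiag z^* q.

Lemma act_su3 (z : S1) (g : SU3) :
  act_mx (val z) (SU3mx g) \in su3_set.
Proof.
have /set_mem[gU gd] := valP (g : set_type su3_set); apply: mem_set; split.
  apply: mul_unitarymx; first exact: mul_unitarymx (zdiag_unitary _ _) gU.
  exact: (zdiag_unitary (S1_conj z)).
rewrite /act_mx !det_mulmx gd mulr1 !det_zdiag ?S1_neq0 ?S1_conj_neq0 //.
by rewrite hpq -expfzMl S1_mulC exp1rz.
Qed.

Definition act (z : S1) (g : SU3) : SU3 := SigSub (act_su3 z g).

Lemma SU3_inj : injective SU3mx.
Proof. by move=> g h /val_inj. Qed.

Lemma SU3mx_act z g : SU3mx (act z g) = act_mx (val z) (SU3mx g).
Proof. by []. Qed.

Lemma act1 g : act S1_one g = g.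
Proof.
apply: SU3_inj; rewrite SU3mx_act /act_mx [val S1_one]/=.
by rewrite rmorph1 !zdiag1 mul1mx mulmx1.
Qed.

Lemma actM z w g : act (S1_mul z w) g = act z (act w g).
Proof.
apply: SU3_inj; rewrite !SU3mx_act /act_mx [val (S1_mul _ _)]/=.
by rewrite rmorphM !zdiagM (zdiagC (val z)^* _ q q) !mulmxA.
Qed.

Lemma S1_mulVl z : S1_mul (S1_conj z) z = S1_one.
Proof. by apply: val_inj; rewrite /= mulrC S1_mulC. Qed.

Lemma actK z g : act (S1_conj z) (act z g) = g.
Proof. by rewrite -actM S1_mulVl act1. Qed.

Definition orbit_rel (g h : SU3) : bool := `[< exists z, h = act z g >].

Lemma orbit_rel_equiv : equiv_class_of orbit_rel.
Proof.
split=> [g|g h|h g k].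
- by apply/asboolP; exists S1_one; rewrite act1.
- by apply/asboolP/asboolP=> -[z ->]; exists (S1_conj z); rewrite actK.
- move=> /asboolP[z ->] /asboolP[w ->]; apply/asboolP; exists (S1_mul w z).
  by rewrite actM.
Qed.
Canonical orbit_equiv_rel := EquivRelPack orbit_rel_equiv.

Definition Eschenburg : Type := quotient_topology {eq_quot orbit_equiv_rel}.
HB.instance Definition _ := Topological.on Eschenburg.
HB.instance Definition _ := Quotient.on Eschenburg.

Definition Epi (g : SU3) : Eschenburg := \pi_Eschenburg g.

End Action.

Section CircleQuotient.
Variables (p q : 'rV[int]_3) (hpq : \sum_i p 0 i = \sum_i q 0 i).
Variables (a b : 'rV[int]_3) (hab : \sum_i a 0 i = \sum_i b 0 i).
Local Notation E := (Eschenburg hpq).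

Lemma actC z w g : act hab w (act hpq z g) = act hpq z (act hab w g).
Proof.
apply: SU3_inj; rewrite !SU3mx_act /act_mx !mulmxA [zdiag _ a *m _]zdiagC.
by rewrite -!mulmxA [zdiag _ q *m _]zdiagC.
Qed.

(* w . [g] = [w^a g wbar^b]; well defined by [Eact_pi]. *)
Definition Eact (w : S1) (x : E) : E := Epi hpq (act hab w (repr x)).

Lemma Epi_eq g h : Epi hpq g = Epi hpq h <-> exists z, h = act hpq z g.
Proof. by split=> [/eqquotP/asboolP|e] //; apply/eqquotP/asboolP. Qed.

Lemma Eact_pi w g : Eact w (Epi hpq g) = Epi hpq (act hab w g).
Proof.
apply/Epi_eq; have /Epi_eq[z e] : Epi hpq (repr (Epi hpq g)) = Epi hpq g.
  exact: reprK.
by exists z; rewrite [in LHS]e actC.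
Qed.

Lemma EpiP (x : E) : exists g, x = Epi hpq g.
Proof. by exists (repr x); rewrite /Epi reprK. Qed.

Definition Eorbit_rel (x y : E) : bool := `[< exists w, y = Eact w x >].

Lemma Eorbit_rel_equiv : equiv_class_of Eorbit_rel.
Proof.
split=> [x|x y|y x u].
- apply/asboolP; exists S1_one; have [g ->] := EpiP x.
  by rewrite Eact_pi act1.
- have [g ->] := EpiP x; have [h ->] := EpiP y.
  by apply/asboolP/asboolP=> -[w ->]; exists (S1_conj w); rewrite (Eact_pi w) Eact_pi actK.
- have [g ->] := EpiP x; move=> /asboolP[z ->] /asboolP[w ->].
  by apply/asboolP; exists (S1_mul w z); rewrite (Eact_pi z) !Eact_pi actM.
Qed.
Canonical Eorbit_equiv_rel := EquivRelPack Eorbit_rel_equiv.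

Definition Oquot : Type := quotient_topology {eq_quot Eorbit_equiv_rel}.
HB.instance Definition _ := Topological.on Oquot.
HB.instance Definition _ := Quotient.on Oquot.

Definition hatpi (x : E) : Oquot := \pi_Oquot x.

Definition E_isotropy (x : E) : set S1 := [set w | Eact w x = x].

Definition E_almost_free : Prop := forall x : E, finite_set (E_isotropy x).

(* (z, w) . g = w^a z^p g zbar^q wbar^b; by [hatpi_eq], the quotient of SU(3)
   by this T^2-action is [Oquot]. *)
Definition T2act (t : S1 * S1) (g : SU3) : SU3 :=
  act hab t.2 (act hpq t.1 g).

Lemma hatpi_eq g h :
  hatpi (Epi hpq g) = hatpi (Epi hpq h) <-> exists t, h = T2act t g.
Proof.
split=> [/eqquotP/asboolP[w]|[[z w] ->]].
  rewrite Eact_pi => /esym/Epi_eq[z ->].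
  by exists (z, w); rewrite /T2act actC.
apply/eqquotP/asboolP; exists w; rewrite Eact_pi /T2act actC /=.
by apply/esym/Epi_eq; exists z.
Qed.

Definition T2_isotropy (g : SU3) : set (S1 * S1) := [set t | T2act t g = g].

Definition T2_kernel : set (S1 * S1) := [set t | forall g, T2act t g = g].

(* An orbifold is here, by definition, the quotient of a smooth manifold by an
   almost free action of a compact Lie group; its dimension is the difference of
   theirs.  [quotient_orbifold n M] says that the quotient of the T^2-invariant
   set [M] by T^2 is an n-dimensional orbifold: [M] is a smooth manifold of dimension n + 2 on which the
   2-dimensional compact Lie group T^2 acts almost freely.  Smoothness of the
   action is automatic, since T^2 acts by real-linear maps of R^18 depending
   smoothly on the group element. *)
Definition quotient_orbifold (n : nat) (M : set SU3) : Prop :=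
  [/\ submanifold (n + 2)%N ((real_coords \o SU3mx) @` M),
      forall t g, M g -> M (T2act t g)
    & forall g, M g -> finite_set (T2_isotropy g)].

(* The orbifold group at the image of g is T2_isotropy g modulo T2_kernel; it
   is non-trivial iff some isotropy element is not in the kernel. *)
Definition singular_locus : set Oquot :=
  [set hatpi (Epi hpq g) | g in [set g | ~ (T2_isotropy g `<=` T2_kernel)]].

Definition U2 (i j : 'I_3) : set SU3 :=
  [set g | (forall k, (SU3mx g i k != 0) = (k == j)) /\
           (forall k, (SU3mx g k j != 0) = (k == i))].

Definition T2sub (s : 'S_3) : set SU3 :=
  [set g | forall i j, (SU3mx g i j != 0) = (j == s i)].

Definition calL (i j : 'I_3) : set E := Epi hpq @` U2 i j.
Definition Csig (s : 'S_3) : set E := Epi hpq @` T2sub s.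

Definition hatL (i j : 'I_3) : set Oquot := hatpi @` calL i j.
Definition hatC (s : 'S_3) : set Oquot := hatpi @` Csig s.

(* hatL i j, with the orbifold structure of U2 i j / T^2 and the topology
   induced from [Oquot], is an orbifold 2-sphere. *)
Definition hatL_orbifold_sphere (i j : 'I_3) : Prop :=
  quotient_orbifold 2 (U2 i j) /\ homeomorphic (hatL i j) (sphere2 R).

End CircleQuotient.
End SU3.

Arguments E_almost_free R {p q} hpq {a b} hab.
Arguments singular_locus R {p q} hpq {a b} hab.
Arguments quotient_orbifold R {p q} hpq {a b} hab n M.
Arguments hatL R {p q} hpq {a b} hab i j.
Arguments hatC R {p q} hpq {a b} hab s.
Arguments hatL_orbifold_sphere R {p q} hpq {a b} hab i j.

(* Linear independence of integer vectors, with scalars Q; it does not depend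
   on whether one takes Z, Q or R as scalars. *)
Definition lin_indep (u v : 'rV[int]_3) : bool :=
  free [:: map_mx intr u : 'rV[rat]_3; map_mx intr v].

(* Main.v *)
Require Import Defs.
From HB Require Import structures.
From mathcomp Require Import ring lra zify.

Set Implicit Arguments.
Unset Strict Implicit.
Unset Printing Implicit Defensive.

Local Open Scope classical_set_scope.
Local Open Scope ring_scope.

(** An element t = (z, w) of the torus T^2 multiplies the entry (x, y) of a
matrix by the weight z^(p_x - q_y) w^(a_x - b_y); this weight is the quotient
of a left weight attached to the row x by a right weight attached to the
column y.  So every question about isotropy is a question about the zero
pattern of the matrix, and the proof has three independent ingredients.

Isotropy.  As its determinant is not zero, a matrix g of SU(3) has nonzero
entries along the graph of some permutation s, so an element fixing g has
weight 1 at each (x, s x).  When p - q_s and a - b_s are independent, a 2 x 2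
minor N of the two vectors is nonzero and forces z^N = w^N = 1: isotropy is
finite.  When they are dependent, the signed permutation matrix of s is fixed
by a one-parameter family with infinitely many w, because p - q_s is not zero.
If t fixes g but does not act trivially, the three left weights are not all
equal, so one row i has a left weight shared by no other row; then row i and
column s i of g vanish outside (i, s i), which puts g in a block U(2)_ij
([singular_U2]).  In a block, either g lies on one of the tori T^2_s, or
orthogonality of the rows makes all four entries of its 2 x 2 part nonzero
([U2_block_neq0]).  Hence the isotropy group is constant along each stratum,
and the singular locus is a union of strata ([singular_locus_union]).

Manifolds.  SU(3) is cut out near each of its points by the Hermitian equation
g g* = 1 and by Im det g = 0, the condition det g = 1 being recovered from the
sign of Re det g; along Z g these equations have the differentials Z + Z* and
Im tr Z, which are jointly onto.  For a block one drops the Hermitian equations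
that couple the row i to the others and adds the vanishing of the off-block
entries ([SU3_submanifold], [U2_submanifold]).

Spheres.  A point of a block is determined by one column (al, ga) of its 2 x 2
part and by its corner de, subject to |al|^2 + |ga|^2 = 1 and |de| = 1.  The
torus acts on these three coordinates through a map T^2 -> T^3 whose image is
the kernel of one primitive monomial n ([torus_image]); up to the moduli,
al^n1 ga^n2 de^n3 is therefore the only invariant.  Rescaled so as to have modulus
|al| |ga|, it gives with |al|^2 - |ga|^2 a continuous map onto the unit sphere
([sphere_map]) whose fibres are exactly the orbits, since n1 and n2 are nonzero
by the independence hypotheses.  The block being compact, the inverse of the
induced bijection is continuous. *)

(** * Monomials on tori *)

Section Torus.
Variable K : numClosedFieldType.
Implicit Types (z w u : K) (e f : int * int * int) (v : K * K * K).

Definition circle3 v := [/\ `|v.1.1| = 1, `|v.1.2| = 1 & `|v.2| = 1].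

(** Exponent vectors and points of the three-dimensional torus are nested
pairs, so that components are available by projection and conversion. *)
Definition monomial v e : K := v.1.1 ^ e.1.1 * v.1.2 ^ e.1.2 * v.2 ^ e.2.

Lemma norm1_neq0 z : `|z| = 1 -> z != 0.
Proof. by move=> h; rewrite -normr_eq0 h oner_eq0. Qed.

Lemma norm1_exp z (n : int) : `|z| = 1 -> `|z ^ n| = 1.
Proof.
by case: n => n h; rewrite ?NegzE -?exprnN ?normfV -?exprnP normrX h expr1n ?invr1.
Qed.

Lemma norm1_monomial v e : circle3 v -> `|monomial v e| = 1.
Proof. by case=> h0 h1 h2; rewrite !normrM !norm1_exp // !mulr1. Qed.

Definition add3 e f : int * int * int :=
  (e.1.1 + f.1.1, e.1.2 + f.1.2, e.2 + f.2).
Definition scale3 (k : int) e : int * int * int := (k * e.1.1, k * e.1.2, k * e.2).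
Definition dot3 e f : int := e.1.1 * f.1.1 + e.1.2 * f.1.2 + e.2 * f.2.
Definition cross3 e f : int * int * int :=
  (e.1.2 * f.2 - e.2 * f.1.2, e.2 * f.1.1 - e.1.1 * f.2,
   e.1.1 * f.1.2 - e.1.2 * f.1.1).

Lemma monomial_add v e f : circle3 v -> monomial v (add3 e f) = monomial v e * monomial v f.
Proof.
case=> /norm1_neq0 h0 /norm1_neq0 h1 /norm1_neq0 h2.
rewrite /monomial /= !expfzDr //; ring.
Qed.

Lemma monomial_scale v k e : monomial v (scale3 k e) = monomial v e ^ k.
Proof. by rewrite /monomial /= !expfzMl !exprz_exp ![k * _]mulrC. Qed.

Lemma monomial_characters z w e f n : z != 0 -> w != 0 ->
  monomial (z ^ e.1.1 * w ^ f.1.1, z ^ e.1.2 * w ^ f.1.2, z ^ e.2 * w ^ f.2) n =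
  z ^ dot3 e n * w ^ dot3 f n.
Proof.
by move=> z0 w0; rewrite /monomial /dot3 /= !expfzMl !exprz_exp !expfzDr //; ring.
Qed.

Lemma unit_root z (N : int) : N != 0 -> `|z| = 1 ->
  exists u, `|u| = 1 /\ u ^ N = z.
Proof.
have pos (n : nat) y : (0 < n)%N -> `|y| = 1 -> exists u : K, `|u| = 1 /\ u ^+ n = y.
  move=> n0 hy; exists (n.-root y); rewrite rootCK //; split=> //.
  by apply/eqP; rewrite -(pexpr_eq1 n0) // -normrX rootCK // hy.
case: N => [[//|n]|n] _ hz; first exact: pos.
have [|u [hu e]] := pos n.+1 z^-1 isT; first by rewrite normfV hz invr1.
by exists u; split=> //; rewrite NegzE -exprnN e invrK.
Qed.

(** The image of the homomorphism T^2 -> T^3 with independent weight vectors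
e1, e2 is the whole kernel of the monomial n, where d n is their cross product
c.  The identity
  (c.c) f = (f.(e2 x c)) e1 + (f.(c x e1)) e2 + (f.c) c
solves the linear problem after multiplication by N = c.c; so one extracts an
N-th root u of v, and corrects it by an N-th root of unity until the monomial n,
and hence the monomial c, is 1 on u.  The correction is possible because n is
primitive, which r witnesses. *)
Lemma torus_image e1 e2 n r (d : int) v :
  d != 0 -> cross3 e1 e2 = scale3 d n -> dot3 r n = 1 -> circle3 v ->
  monomial v n = 1 ->
  exists z w, [/\ `|z| = 1, `|w| = 1 &
    v = (z ^ e1.1.1 * w ^ e2.1.1, z ^ e1.1.2 * w ^ e2.1.2, z ^ e1.2 * w ^ e2.2)].
Proof.
move=> d0 cE rn [h0 h1 h2] vn.
pose N := d ^+ 2 * dot3 n n.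
have n0 : dot3 n n != 0.
  apply: contra_eqN rn => /eqP nn.
  have [n1 n2 n3] : [/\ n.1.1 = 0, n.1.2 = 0 & n.2 = 0].
    by move: nn; rewrite /dot3; split; nia.
  by rewrite /dot3 n1 n2 n3 !mulr0.
have N0 : N != 0 by rewrite mulf_neq0 // expf_neq0.
have [x0 [x01 x0N]] := unit_root N0 h0.
have [x1 [x11 x1N]] := unit_root N0 h1.
have [x2 [x21 x2N]] := unit_root N0 h2.
pose x := (x0, x1, x2); have cx : circle3 x by [].
pose eps := monomial x n.
have eps1 : `|eps| = 1 by exact: norm1_monomial.
have vE : v = (x0 ^ N, x1 ^ N, x2 ^ N) by rewrite x0N x1N x2N -!surjective_pairing.
have epsN : eps ^ N = 1.
  by rewrite -monomial_scale -vn vE /monomial /= !exprz_exp.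
(* the correction by powers of eps changes the monomial n by eps^(- r.n) *)
pose u : K * K * K :=
  (x0 * eps ^ (- r.1.1), x1 * eps ^ (- r.1.2), x2 * eps ^ (- r.2)).
have cu : circle3 u by split; rewrite /= normrM norm1_exp // ?x01 ?x11 ?x21 mulr1.
have epsK k : (eps ^ k) ^ N = 1 by rewrite exprzAC epsN exp1rz.
have uN : v = (u.1.1 ^ N, u.1.2 ^ N, u.2 ^ N).
  by rewrite vE /=; congr (_, _, _); rewrite expfzMl epsK mulr1.
have un : monomial u n = 1.
  have -> : monomial u n = monomial x n * eps ^ (- dot3 r n).
    rewrite {1}/monomial /= (expfzMl x0) (expfzMl x1) (expfzMl x2) !exprz_exp.
    rewrite /dot3 !opprD (expfzDr _ _ (norm1_neq0 eps1)) (expfzDr _ _ (norm1_neq0 eps1)).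
    by rewrite !mulNr /monomial /=; ring.
  by rewrite rn -/eps mulfV // norm1_neq0.
have uc : monomial u (cross3 e1 e2) = 1 by rewrite cE monomial_scale un exp1rz.
pose c := cross3 e1 e2.
have NE : N = dot3 c c by rewrite /c cE /N /dot3 /=; ring.
exists (monomial u (cross3 e2 c)), (monomial u (cross3 c e1)).
(* the identity of exponents holds up to multiples of c, on which u is trivial *)
have key k1 k2 j f :
    add3 (add3 (scale3 k1 (cross3 e2 c)) (scale3 k2 (cross3 c e1))) (scale3 j c) = f ->
    monomial u f = monomial u (cross3 e2 c) ^ k1 * monomial u (cross3 c e1) ^ k2.
  by move=> <-; rewrite !monomial_add // !monomial_scale uc exp1rz mulr1.
split; try exact: norm1_monomial.
rewrite {1}uN; congr (_, _, _).
- rewrite -(key _ _ c.1.1 (N, 0, 0)); first by rewrite /monomial /= !expr0z !mulr1.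
  by rewrite NE /c /add3 /scale3 /cross3 /dot3 /=; congr (_, _, _); ring.
- rewrite -(key _ _ c.1.2 (0, N, 0)); first by rewrite /monomial /= !expr0z mulr1 mul1r.
  by rewrite NE /c /add3 /scale3 /cross3 /dot3 /=; congr (_, _, _); ring.
- rewrite -(key _ _ c.2 (0, 0, N)); first by rewrite /monomial /= !expr0z !mul1r.
  by rewrite NE /c /add3 /scale3 /cross3 /dot3 /=; congr (_, _, _); ring.
Qed.

(** A nonzero integer vector is a multiple of a primitive one; r is a Bezout
certificate of primitivity. *)
Lemma primitive_vector e : e != (0, 0, 0) -> exists d n r,
  [/\ d != 0 :> int, e = scale3 d n & dot3 r n = 1].
Proof.
case: e => [[x y] t] e0.
pose g := gcdz x y; pose d := gcdz g t.
have d0 : d != 0.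
  apply: contraNneq e0 => /eqP; rewrite gcdz_eq0 gcdz_eq0 => /andP[/andP[/eqP-> /eqP->] /eqP->].
  by [].
have [u [v uv]] := Bezoutz x y.
have [u' [v' uv']] := Bezoutz g t.
have dg : (d %| g)%Z by exact: dvdz_gcdl.
have dx : (d %| x)%Z by apply: dvdz_trans dg _; exact: dvdz_gcdl.
have dy : (d %| y)%Z by apply: dvdz_trans dg _; exact: dvdz_gcdr.
have dt : (d %| t)%Z by exact: dvdz_gcdr.
have /dvdzP[x' xE] := dx; have /dvdzP[y' yE] := dy; have /dvdzP[t' tE] := dt.
exists d, (x', y', t'), (u' * u, u' * v, v'); split=> //.
  by rewrite /scale3 /= xE yE tE; congr (_, _, _); rewrite mulrC.
have dE : d = u' * (u * x + v * y) + v' * t by rewrite uv; exact/esym.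
by apply: (mulfI d0); rewrite mulr1 [RHS]dE xE yE tE /dot3 /=; ring.
Qed.
End Torus.

Lemma finite_unit_roots (K : closedFieldType) (N : int) :
  N != 0 -> finite_set [set z : K | z ^ N = 1].
Proof.
have pos (n : nat) : (0 < n)%N -> finite_set [set z : K | z ^+ n = 1].
  move=> n0; have [r rE] := closed_field_poly_normal ('X^n - 1 : {poly K}).
  apply: (sub_finite_set _ (finite_seq r)) => z /= zn.
  have : root ('X^n - 1 : {poly K}) z by rewrite rootE !hornerE zn subrr.
  rewrite rE rootZ ?root_prod_XsubC // lead_coef_eq0.
  by rewrite -size_poly_gt0 size_XnsubC.
case: N => [[//|n]|n] _; first exact: pos.
apply: (sub_finite_set _ (pos n.+1 isT)) => z /=; rewrite NegzE => h.
by rewrite -(invrK (z ^+ n.+1)) exprnN h invr1.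
Qed.

Section FieldExponents.
Variable F : fieldType.
Implicit Types z w c : F.

(** Cramer's rule in exponents: two independent characters that are trivial at
(z, w) force both z and w to be roots of unity, of order dividing the minor. *)
Lemma expfz_minor z w (u0 u1 v0 v1 : int) : z != 0 -> w != 0 ->
  z ^ u0 * w ^ v0 = 1 -> z ^ u1 * w ^ v1 = 1 ->
  z ^ (u0 * v1 - u1 * v0) = 1 /\ w ^ (u0 * v1 - u1 * v0) = 1.
Proof.
move=> z0 w0 e0 e1; split.
- transitivity ((z ^ u0 * w ^ v0) ^ v1 / (z ^ u1 * w ^ v1) ^ v0).
    rewrite invr_expz !expfzMl !exprz_exp !mulrN.
    by rewrite mulrACA -!expfzDr // [v1 * v0]mulrC subrr expr0z mulr1.
  by rewrite e0 e1 !exp1rz divr1.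
- transitivity ((z ^ u1 * w ^ v1) ^ u0 / (z ^ u0 * w ^ v0) ^ u1).
    rewrite invr_expz !expfzMl !exprz_exp !mulrN.
    rewrite mulrACA -!expfzDr // [u1 * u0]mulrC subrr expr0z mul1r.
    by congr (_ ^ _); ring.
  by rewrite e0 e1 !exp1rz divr1.
Qed.

Lemma expfz_weight z w c (i j k l : int) : z != 0 -> w != 0 ->
  w ^ k * (z ^ i * c * z^-1 ^ j) * w^-1 ^ l = z ^ (i - j) * w ^ (k - l) * c.
Proof. by move=> z0 w0; rewrite !exprz_inv !expfzDr //; ring. Qed.

End FieldExponents.

(** * Minors of pairs of integer vectors *)

Lemma forall_ord3 (P : 'I_3 -> Prop) :
  P ord0 -> P (lift ord0 ord0) -> P (lift ord0 (lift ord0 ord0)) -> forall x, P x.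
Proof.
move=> P0 P1 P2 [[|[|[|//]]] h].
- by rewrite (_ : Ordinal h = ord0) //; exact: val_inj.
- by rewrite (_ : Ordinal h = lift ord0 ord0) //; exact: val_inj.
- by rewrite (_ : Ordinal h = lift ord0 (lift ord0 ord0)) //; exact: val_inj.
Qed.

Section Minors.
Implicit Types u v : 'rV[int]_3.

Definition minor u v (x y : 'I_3) : int := u 0 x * v 0 y - u 0 y * v 0 x.

Lemma lin_indepP u v : lin_indep u v <-> exists x y, minor u v x y != 0.
Proof.
rewrite /lin_indep free_cons span_seq1 seq1_free; split.
  move=> /andP[uv v0]; apply: contrapT => h.
  have m0 x y : u 0 x * v 0 y = u 0 y * v 0 x.
    apply/eqP; rewrite -subr_eq0; apply: contrapT => /negP k.
    by apply: h; exists x, y.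
  have [y vy] : exists y, v 0 y != 0.
    apply: contrapT => k; move/negP: v0; apply; apply/eqP/rowP => y.
    rewrite !mxE; case: (eqVneq (v 0 y) 0) => [-> //|vy].
    by case: k; exists y.
  move/negP: uv; apply; apply/vlineP; exists ((u 0 y)%:~R / (v 0 y)%:~R).
  apply/rowP => x; rewrite !mxE mulrAC.
  apply: (canRL (mulfK _)); first by rewrite intr_eq0.
  by rewrite -!intrM m0.
move=> [x [y m0]]; apply/andP; split.
  apply: contraNN m0 => /vlineP[k /rowP uE].
  have := uE x; have := uE y; rewrite !mxE => uy ux.
  rewrite /minor -(intr_eq0 rat) rmorphB !rmorphM /= ux uy; apply/eqP; ring.
apply: contraNneq m0 => /rowP vE; have := vE x; have := vE y; rewrite !mxE.
by rewrite /minor => /eqP + /eqP; rewrite !intr_eq0 => /eqP -> /eqP ->; rewrite !mulr0 subr0.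
Qed.

(** For vectors with vanishing coordinate sum the cross product is a multiple of
(1, 1, 1), so that all the minors agree up to sign. *)
Lemma lin_indep_minor u v x y : \sum_i u 0 i = 0 -> \sum_i v 0 i = 0 ->
  lin_indep u v -> x != y -> minor u v x y != 0.
Proof.
rewrite !big_ord_recl !big_ord0 /= => su sv /lin_indepP[x' [y' h]] xy.
apply: contraNneq h; rewrite /minor.
move: x y xy x' y'; do 2!apply: forall_ord3 => //; move=> _; do 2!apply: forall_ord3;
 move=> h; apply/eqP; nia.
Qed.

End Minors.

(** * Zero patterns of matrices in SU(3) *)

Section SU3Entries.
Variable R : realType.
Local Notation C := R[i].
Implicit Types g h : SU3 R.

Lemma SU3_unitary g : SU3mx g \is unitarymx.
Proof. by have /set_mem[] := valP (g : set_type (@su3_set R)). Qed.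

Lemma SU3_det g : \det (SU3mx g) = 1.
Proof. by have /set_mem[] := valP (g : set_type (@su3_set R)). Qed.

Lemma exists_SU3 (A : 'M[C]_3) : A \is unitarymx -> \det A = 1 -> exists g : SU3 R, SU3mx g = A.
Proof.
move=> hA dA; have m : A \in @su3_set R by apply: mem_set.
by exists (SigSub m : set_type (@su3_set R)).
Qed.

Lemma SU3_rows g x y : \sum_k SU3mx g x k * (SU3mx g y k)^* = (x == y)%:R.
Proof.
have /unitarymxP/matrixP/(_ x y) := SU3_unitary g.
by rewrite !mxE => <-; apply: eq_bigr => k _; rewrite !mxE.
Qed.

(** The inverse of g is both its adjugate and its conjugate transpose. *)
Lemma SU3_cofactor g x y : (SU3mx g x y)^* = cofactor (SU3mx g) x y.
Proof.
have U : SU3mx g *m (SU3mx g)^t*%sesqui = 1%:M by apply/unitarymxP/SU3_unitary.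
have A : \adj (SU3mx g) *m SU3mx g = 1%:M by rewrite mul_adj_mx SU3_det.
have : \adj (SU3mx g) = (SU3mx g)^t*%sesqui.
  by rewrite -[LHS]mulmx1 -U mulmxA A mul1mx.
by move=> /matrixP/(_ y x); rewrite !mxE => <-.
Qed.

Lemma SU3_cols g x y : \sum_k SU3mx g k x * (SU3mx g k y)^* = (x == y)%:R.
Proof.
have A : \adj (SU3mx g) *m SU3mx g = 1%:M by rewrite mul_adj_mx SU3_det.
move/matrixP/(_ y x): A; rewrite !mxE eq_sym => <-; apply: eq_bigr => k _.
by rewrite !mxE SU3_cofactor mulrC.
Qed.

Lemma SU3_transversal g : exists s : 'S_3, forall x, SU3mx g x (s x) != 0.
Proof.
apply: contrapT => h.
have : \det (SU3mx g) = 0.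
  rewrite /determinant big1 // => s _.
  have [x gx] : exists x, SU3mx g x (s x) == 0.
    by apply: contrapT => k; apply: h; exists s => x; apply/negP => e; apply: k; exists x.
  by rewrite (bigD1 x) //= (eqP gx) mul0r mulr0.
by rewrite SU3_det => /eqP; rewrite oner_eq0.
Qed.

(** By the cofactor formula an entry depends only on the minor that avoids its
row and its column. *)
Lemma SU3_entry_determined g h x y :
  (forall x' y', x' != x -> y' != y -> SU3mx g x' y' = SU3mx h x' y') ->
  SU3mx g x y = SU3mx h x y.
Proof.
move=> e; apply: (can_inj (@conjCK _)); rewrite !SU3_cofactor /cofactor.
congr (_ * \det _); apply/matrixP => k l.
by rewrite !mxE e // eq_sym neq_lift.
Qed.

(** Inside SU(3) the requirement that the corner is nonzero is automatic, since
rows have norm 1; this makes the block a closed, linear condition. *)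
Lemma U2P g i j : U2 i j g <->
  forall x y, (x == i) != (y == j) -> SU3mx g x y = 0.
Proof.
split=> [[r c] x y|h].
  have [->|xi] := eqVneq x i; have [->|yj] := eqVneq y j => //= _; apply/eqP.
    by rewrite -[_ == 0]negbK r.
  by rewrite -[_ == 0]negbK c.
have gij : SU3mx g i j != 0.
  apply/eqP => gij; have := SU3_rows g i i; rewrite big1 ?eqxx => [/eqP|k _].
    by rewrite eq_sym oner_eq0.
  have [->|kj] := eqVneq k j; first by rewrite gij mul0r.
  by rewrite h ?mul0r // eqxx (negbTE kj).
split=> k.
  have [->|kj] := eqVneq k j; first by rewrite gij.
  by rewrite h ?eqxx // (negbTE kj).
have [->|ki] := eqVneq k i; first by rewrite gij.
by rewrite h ?eqxx // (negbTE ki).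
Qed.

Lemma T2sub_U2 g (s : 'S_3) i : T2sub s g -> U2 i (s i) g.
Proof.
move=> h; apply/U2P => x y xy; apply/eqP; rewrite -[_ == 0]negbK h.
apply: contra xy => /eqP ->; by rewrite (inj_eq perm_inj).
Qed.

Lemma T2sub_entries_norm g (s : 'S_3) x : T2sub s g -> `|SU3mx g x (s x)| = 1.
Proof.
move=> h; have := SU3_rows g x x; rewrite (bigD1 (s x)) //= big1 => [|k ks].
  by rewrite addr0 eqxx -normCK => /eqP; rewrite pexpr_eq1 // => /eqP.
have : ~~ (SU3mx g x k != 0) by rewrite h.
by rewrite negbK => /eqP ->; rewrite mul0r.
Qed.

(** The permutation matrix multiplied by its sign has determinant sign^4 = 1. *)
Lemma T2sub_neq0 (s : 'S_3) : exists g, @T2sub R s g.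
Proof.
have [||g gE] := @exists_SU3 ((-1) ^+ s *: perm_mx s).
- apply/unitarymxP/matrixP => x y; rewrite !mxE.
  rewrite (bigD1 (s x)) //= big1 ?addr0 => [|k ks].
    rewrite !mxE eqxx (inj_eq perm_inj) eq_sym mulr1 rmorphM /= rmorph_sign rmorph_nat.
    by rewrite mulrA -expr2 sqrr_sign mul1r.
  by rewrite !mxE eq_sym (negbTE ks) mulr0 mul0r.
- by rewrite detZ det_perm -exprM -exprD -signr_odd oddD oddM andbT addbb.
exists g => x y; rewrite gE !mxE mulf_eq0 signr_eq0 /= (eq_sym y).
by case: (s x == y); rewrite ?oner_eq0 ?eqxx.
Qed.

(** If an entry of the 2 x 2 part vanished, orthogonality of its two rows would
make the opposite entry vanish too, leaving only the graph of a permutation. *)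
Lemma U2_block_neq0 g i j x y : U2 i j g -> (forall s, ~ T2sub s g) ->
  x != i -> y != j -> SU3mx g x y != 0.
Proof.
move=> gU gT xi yj; apply/eqP => gxy; have [s hs] := SU3_transversal g.
have z := (U2P g i j).1 gU.
have sij : s i = j.
  apply/eqP; apply/negPn/negP => sj; have := hs i; rewrite z ?eqxx //.
have sxy : s x != y by apply/eqP => e; have := hs x; rewrite e gxy eqxx.
apply: (gT s) => k l.
have [->|ls] := eqVneq l (s k); first by rewrite hs.
apply/negbTE; rewrite negbK; apply/eqP.
have [kE|ki] := eqVneq k i.
  by rewrite kE z // eqxx; rewrite kE sij in ls; rewrite (negbTE ls).
have [lE|lj] := eqVneq l j.
  by rewrite lE z // eqxx (negbTE ki).
have rowx m : m != s x -> SU3mx g x m = 0.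
  move=> ms; have [->|mj] := eqVneq m j; first by rewrite z // eqxx (negbTE xi).
  suff -> : m = y by [].
  have sxj : s x != j by rewrite -sij (inj_eq perm_inj).
  by move: (s x) ms mj sxj sxy yj => t; clear; move: m j y t;
    do 4! apply: forall_ord3.
have [kx|kx] := eqVneq k x; first by rewrite kx rowx // -kx.
have lsx : l = s x.
  have sxj : s x != j by rewrite -sij (inj_eq perm_inj).
  have skj : s k != j by rewrite -sij (inj_eq perm_inj).
  have : s x != s k by rewrite (inj_eq perm_inj) eq_sym.
  by move: (s x) (s k) ls lj sxj skj => t t'; clear; move: l j t t';
    do 4! apply: forall_ord3.
have := SU3_rows g k x; rewrite (negbTE kx) (bigD1 (s x)) //= big1.
  move/eqP; rewrite addr0 mulf_eq0 conjC_eq0 (negbTE (hs x)) orbF => /eqP h.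
  by rewrite lsx h.
by move=> m ms; rewrite rowx // rmorph0 mulr0.
Qed.

End SU3Entries.

(** * Weights of the torus action and almost freeness *)

Section Weights.
Variable R : realType.
Variables (p q : 'rV[int]_3) (hpq : \sum_i p 0 i = \sum_i q 0 i).
Variables (a b : 'rV[int]_3) (hab : \sum_i a 0 i = \sum_i b 0 i).
Local Notation C := R[i].
Implicit Types (g h : SU3 R) (t : S1 R * S1 R) (s : 'S_3).

Definition left_weight t x : C := val t.1 ^ p 0 x * val t.2 ^ a 0 x.
Definition right_weight t y : C := val t.1 ^ q 0 y * val t.2 ^ b 0 y.
Definition weight t x y : C :=
  val t.1 ^ (p 0 x - q 0 y) * val t.2 ^ (a 0 x - b 0 y).

Lemma S1_inv (z : S1 R) : (val z)^* = (val z)^-1.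
Proof. by rewrite -[LHS](mulKf (S1_neq0 z)) S1_mulC mulr1. Qed.

(** The weight is a quotient of a row factor by a column factor; this is what
propagates triviality of weights along the zero pattern of a matrix. *)
Lemma weight_eq1 t x y : weight t x y = 1 <-> left_weight t x = right_weight t y.
Proof.
rewrite /weight !expfzDr ?S1_neq0 // -!invr_expz.
have u : right_weight t y != 0 by rewrite mulf_neq0 ?expfz_neq0 ?S1_neq0.
have -> : val t.1 ^ p 0 x / val t.1 ^ q 0 y * (val t.2 ^ a 0 x / val t.2 ^ b 0 y)
  = left_weight t x / right_weight t y by rewrite mulrACA -invfM.
split=> [/(canRL (divfK u))|->]; first by rewrite mul1r.
by rewrite divff.
Qed.

Lemma norm_weight t x y : `|weight t x y| = 1.
Proof. by rewrite normrM !norm1_exp ?S1_norm // mulr1. Qed.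

Lemma weight_neq0 t x y : weight t x y != 0.
Proof. exact/norm1_neq0/norm_weight. Qed.

Lemma T2act_entry t g x y :
  SU3mx (T2act hpq hab t g) x y = weight t x y * SU3mx g x y.
Proof.
rewrite /T2act !SU3mx_act /act_mx /zdiag !mul_mx_diag !mul_diag_mx !mxE !S1_inv.
by rewrite expfz_weight ?S1_neq0.
Qed.

Lemma T2act_entry_neq0 t g x y :
  (SU3mx (T2act hpq hab t g) x y != 0) = (SU3mx g x y != 0).
Proof. by rewrite T2act_entry mulf_eq0 (negbTE (weight_neq0 _ _ _)). Qed.

Lemma T2_isotropyP t g : T2act hpq hab t g = g <->
  forall x y, SU3mx g x y != 0 -> weight t x y = 1.
Proof.
split=> [e x y gxy|h].
  by apply: (mulIf gxy); rewrite -T2act_entry e mul1r.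
apply: SU3_inj; apply/matrixP => x y; rewrite T2act_entry.
have [->|gxy] := eqVneq (SU3mx g x y) 0; first by rewrite mulr0.
by rewrite h // mul1r.
Qed.

Lemma U2_T2act t g i j : U2 i j g -> U2 i j (T2act hpq hab t g).
Proof. by case=> r c; split=> k; rewrite T2act_entry_neq0. Qed.

Lemma T2sub_T2act t g s : T2sub s g -> T2sub s (T2act hpq hab t g).
Proof. by move=> h x y; rewrite T2act_entry_neq0. Qed.

Local Notation du s := (p - col_perm s q).
Local Notation dv s := (a - col_perm s b).

Lemma sum_sub_col_perm (u v : 'rV[int]_3) s :
  \sum_i u 0 i = \sum_i v 0 i -> \sum_i (u - col_perm s v) 0 i = 0.
Proof.
move=> uv; under eq_bigr do rewrite !mxE.
rewrite sumrB uv [X in X - _](reindex_inj (@perm_inj _ s)); exact: subrr.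
Qed.

Lemma minor_neq0 s x y : lin_indep (du s) (dv s) -> x != y ->
  minor (du s) (dv s) x y != 0.
Proof. by apply: lin_indep_minor; apply: sum_sub_col_perm. Qed.

Lemma weight_perm t x s : weight t x (s x) = val t.1 ^ (du s) 0 x * val t.2 ^ (dv s) 0 x.
Proof. by rewrite !mxE. Qed.

Lemma finite_weights s : lin_indep (du s) (dv s) ->
  finite_set [set t | forall x, weight t x (s x) = 1].
Proof.
move=> h; pose N := minor (du s) (dv s) ord0 ord_max.
have N0 : N != 0 by exact: minor_neq0.
have F : finite_set [set z : S1 R | val z ^ N = 1].
  apply: (@finite_preimage _ _ _ val) (finite_unit_roots _ N0).
  by move=> z w _ _ /val_inj.
apply: (sub_finite_set _ (finite_setX F F)) => -[z w] /= e.
have := e ord0; have := e ord_max; rewrite !weight_perm /= => e1 e0.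
by apply: expfz_minor; rewrite ?S1_neq0.
Qed.

Lemma T2_isotropy_finite g : (forall s, lin_indep (du s) (dv s)) ->
  finite_set (T2_isotropy hpq hab g).
Proof.
move=> h; have [s gs] := SU3_transversal g.
by apply: sub_finite_set (finite_weights (h s)) => t /T2_isotropyP e x; apply: e.
Qed.

Lemma E_isotropyP w g : E_isotropy hab (Epi hpq g) w <->
  exists z, T2act hpq hab (z, w) g = g.
Proof.
rewrite /E_isotropy /= Eact_pi; split=> [/Epi_eq[z e]|[z e]].
  by exists z; rewrite /T2act actC /= -e.
by apply/Epi_eq; exists z; rewrite -{1}e /T2act actC.
Qed.

(** The points with real part in [0, 1] are already infinitely many. *)
Lemma infinite_S1 : infinite_set [set: S1 R].
Proof.
move=> fin; have cp : finite_set [set z : C | `|z| = 1].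
  apply: (sub_finite_set _ (finite_image (val : S1 R -> C) fin)) => z hz /=.
  by exists (SigSub (S1_mem hz)).
pose f (x : R) : C := (x +i* Num.sqrt (1 - x ^+ 2))%C.
have fi : finite_set [set x : R | 0 <= x <= 1].
  have fcp : finite_set (f @^-1` [set z : C | `|z| = 1]).
    by apply: finite_preimage cp => x y _ _ [].
  apply: (sub_finite_set _ fcp) => x /= /andP[x0 x1].
  rewrite normc_def /= sqr_sqrtr ?subr_ge0 ?expr_le1 //.
  by rewrite addrC subrK sqrtr1.
pose k (n : nat) : R := n.+1%:R^-1.
apply: infinite_nat; apply: (@sub_finite_set _ setT (k @^-1` [set x : R | 0 <= x <= 1])).
  by move=> n _ /=; rewrite invr_ge0 ler0n invf_le1 ?ltr0n // ler1n.
apply: finite_preimage fi => m n _ _ /invr_inj/eqP.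
by rewrite eqr_nat eqSS => /eqP.
Qed.

(** If the two vectors are dependent, u_x v = v_x u for a coordinate u_x that is
not zero, and (y^(-v_x), y^(u_x)) fixes T^2_s for every y.  Since u_x is not zero,
y^(u_x) takes every value on the circle. *)
Lemma almost_free_lin_indep s :
  du s != 0 -> E_almost_free R hpq hab -> lin_indep (du s) (dv s).
Proof.
move=> u0 af; apply: contrapT => dep.
have [x ux] : exists x, (du s) 0 x != 0.
  apply: contrapT => h; move/eqP: u0; apply; apply/rowP => x; rewrite [RHS]mxE.
  by apply/eqP; apply: contrapT => /negP k; apply: h; exists x.
have m0 y : (du s) 0 x * (dv s) 0 y = (du s) 0 y * (dv s) 0 x.
  apply/eqP; rewrite -subr_eq0; apply: contrapT => /negP h; apply: dep.
  by apply/lin_indepP; exists x, y.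
have [g gs] := T2sub_neq0 R s.
apply: infinite_S1; apply: (sub_finite_set _ (finite_image id (af (Epi hpq g)))).
move=> y _; have [u [u1 uE]] := unit_root ux (S1_norm y).
exists y => //; apply/E_isotropyP.
have z1 : `|u ^ (- (dv s) 0 x)| = 1 by exact: norm1_exp.
exists (SigSub (S1_mem z1)); apply/T2_isotropyP => k l; rewrite gs => /eqP ->.
rewrite weight_perm /= -uE !exprz_exp -expfzDr ?norm1_neq0 //.
by rewrite m0 mulrC mulrN addNr expr0z.
Qed.

Lemma lin_indep_almost_free :
  (forall s, lin_indep (du s) (dv s)) -> E_almost_free R hpq hab.
Proof.
move=> h x; have [g ->] := EpiP x.
apply: (sub_finite_set _ (finite_image snd (T2_isotropy_finite g h))) => w.
by move=> /E_isotropyP[z e]; exists (z, w).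
Qed.

(** The three phases comparing two points of T^2_s have product 1, because both
determinants are 1, and (1, 1, 1) is a primitive vector orthogonal to the
weights; so the torus realises every such triple of phases. *)
Lemma T2sub_orbit s g h : lin_indep (du s) (dv s) ->
  T2sub s g -> T2sub s h -> exists t, h = T2act hpq hab t g.
Proof.
move=> li gs hs.
pose i0 : 'I_3 := ord0; pose i1 : 'I_3 := lift ord0 ord0.
pose i2 : 'I_3 := lift ord0 (lift ord0 ord0).
pose r x := SU3mx h x (s x) / SU3mx g x (s x).
have r1 x : `|r x| = 1 by rewrite normf_div !T2sub_entries_norm // divr1.
pose tri (u : 'rV[int]_3) : int * int * int := (u 0 i0, u 0 i1, u 0 i2).
have prod1 (k : SU3 R) : T2sub s k ->
    SU3mx k i0 (s i0) * SU3mx k i1 (s i1) * SU3mx k i2 (s i2) = (-1) ^+ s.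
  move=> ks; have := SU3_det k; rewrite /determinant (bigD1 s) //= [X in _ + X]big1.
    rewrite addr0 !big_ord_recl big_ord0 mulr1 => e.
    by rewrite -mulrA -[LHS](signrMK s) e mulr1.
  move=> s' ss'; have [x sx] : exists x, s' x != s x.
    apply: contrapT => e; move/negP: ss'; apply; apply/eqP/permP => x.
    by apply/eqP; apply: contrapT => /negP e'; apply: e; exists x.
  have := ks x (s' x); rewrite (negbTE sx) => /negbFE/eqP k0.
  by rewrite (bigD1 x) //= k0 mul0r mulr0.
(* the cross product of two vectors of coordinate sum 0 is kap (1, 1, 1) *)
pose kap := minor (du s) (dv s) i0 i1.
have k0 : kap != 0 by apply: minor_neq0.
have [||||z [w [z1 w1 e]]] := @torus_image _ (tri (du s)) (tri (dv s)) (1, 1, 1)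
  (1, 0, 0) kap (r i0, r i1, r i2) k0.
- have := sum_sub_col_perm s hab; have := sum_sub_col_perm s hpq.
  rewrite !big_ord_recl !big_ord0 -[lift _ _]/i1 -[lift ord0 (lift _ _)]/i2 -[ord0]/i0.
  rewrite /kap /minor /cross3 /scale3 /tri /=.
  move: ((du s) 0 i0) ((du s) 0 i1) ((du s) 0 i2) ((dv s) 0 i0) ((dv s) 0 i1) ((dv s) 0 i2).
  by move=> u0 u1 u2 v0 v1 v2 su sv; congr (_, _, _); nia.
- by [].
- by split; rewrite /=.
- rewrite /monomial /= !expr1z /r !mulf_div prod1 // prod1 // divff //.
  by rewrite signr_eq0.
exists (SigSub (S1_mem z1), SigSub (S1_mem w1)).
apply: SU3_inj; apply/matrixP => x y; rewrite T2act_entry.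
have [->|yx] := eqVneq y (s x); last first.
  have := gs x y; have := hs x y; rewrite (negbTE yx) => /negbFE/eqP -> /negbFE/eqP ->.
  by rewrite mulr0.
rewrite weight_perm /=.
have gx0 : SU3mx g x (s x) != 0 by rewrite gs.
apply: (canRL (divfK gx0)); rewrite -/(r x).
by case: e; move: x {gx0}; apply: forall_ord3.
Qed.
End Weights.

(** * Incidence of the strata and the singular locus *)

(** Composing with a transposition moves the value at i, so the classes of
permutations according to that value have equal size, namely 6 / 3. *)
Lemma card_perm_eq (i j : 'I_3) : #|[set s : 'S_3 | s i == j]%SET| = 2%N.
Proof.
have same k : #|[set s : 'S_3 | s i == k]%SET| = #|[set s : 'S_3 | s i == j]%SET|.
  rewrite -(card_imset _ (mulIg (tperm k j))); congr #|pred_of_set _|.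
  apply/setP => s; rewrite !inE; apply/imsetP/eqP => [[s' + ->]|sj].
    by rewrite inE => /eqP s'k; rewrite permM s'k tpermL.
  exists (s * tperm k j)%g; last by rewrite -mulgA tperm2 mulg1.
  by rewrite inE permM sj tpermR.
have : (\sum_(k : 'I_3) #|[set s : 'S_3 | s i == k]%SET| = 3`!)%N.
  rewrite -card_Sn -sum1_card (partition_big (fun s : 'S_3 => s i) xpredT) //=.
  by apply: eq_bigr => k _; rewrite sum1dep_card; apply: eq_card => s; rewrite !inE.
rewrite (eq_bigr _ (fun k _ => same k)) sum_nat_const card_ord => /eqP.
by rewrite -[3`!]/(3 * 2)%N eqn_pmul2l // => /eqP.
Qed.

Section Incidence.
Variable R : realType.
Variables (p q : 'rV[int]_3) (hpq : \sum_i p 0 i = \sum_i q 0 i).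
Variables (a b : 'rV[int]_3) (hab : \sum_i a 0 i = \sum_i b 0 i).
Implicit Types (g h : SU3 R) (t : S1 R * S1 R) (s : 'S_3).
Local Notation pt g := (hatpi hab (Epi hpq g)).
Local Notation hatLij := (hatL R hpq hab).
Local Notation hatCs := (hatC R hpq hab).

Lemma hatLP i j g : hatLij i j (pt g) <-> U2 i j g.
Proof.
split=> [[_ [h hU <-] /hatpi_eq[t ->]]|gU]; first exact: U2_T2act.
by exists (Epi hpq g) => //; exists g.
Qed.

Lemma hatCP s g : hatCs s (pt g) <-> T2sub s g.
Proof.
split=> [[_ [h hT <-] /hatpi_eq[t ->]]|gT]; first exact: T2sub_T2act.
by exists (Epi hpq g) => //; exists g.
Qed.

Lemma OquotP (x : Oquot R hpq hab) : exists g : SU3 R, x = pt g.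
Proof.
have [g gE] := EpiP (repr x); exists g.
by rewrite -gE /hatpi reprK.
Qed.

Lemma hatC_point s : lin_indep (p - col_perm s q) (a - col_perm s b) ->
  exists x, hatCs s = [set x].
Proof.
move=> li; have [g gT] := T2sub_neq0 R s; exists (pt g).
apply/seteqP; split=> x /=.
  have [h ->] := OquotP x => /hatCP hT.
  by apply/esym/hatpi_eq; exact: T2sub_orbit gT hT.
by move=> ->; apply/hatCP.
Qed.

Lemma T2sub_inj s s' g : T2sub s g -> T2sub s' g -> s = s'.
Proof.
move=> gs gs'; apply/permP => x; apply/eqP.
by rewrite -(gs' x (s x)) gs.
Qed.

Lemma hatC_inj : injective hatCs.
Proof.
move=> s s' e; have [g gT] := T2sub_neq0 R s.
apply: (T2sub_inj gT); apply/hatCP; rewrite -e; exact/hatCP.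
Qed.

Lemma hatC_sub_hatL i j s : hatCs s `<=` hatLij i j <-> s i = j.
Proof.
split=> [sub|<-]; last first.
  by move=> x; have [g ->] := OquotP x => /hatCP gT; apply/hatLP/T2sub_U2.
have [g gT] := T2sub_neq0 R s.
have /sub/hatLP gU : hatCs s (pt g) by apply/hatCP.
by apply/esym/eqP; rewrite -gT gU.1.
Qed.

(** Two different blocks can only share points with two prescribed rows and
columns, hence with a single possible position in the remaining row. *)
Lemma U2_meet i j k l g : (i, j) <> (k, l) -> U2 i j g -> U2 k l g ->
  exists s, [/\ s i = j, s k = l & T2sub s g].
Proof.
move=> ne [ri ci] [rk ck].
have gij : SU3mx g i j != 0 by rewrite ri.
have gkl : SU3mx g k l != 0 by rewrite rk.
have ik : i != k.
  by apply/eqP => ik; apply: ne; rewrite -ik in gkl *; move: gkl; rewrite ri => /eqP ->.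
have jl : j != l.
  by apply/eqP => jl; apply: ne; rewrite -jl in gkl *; move: gkl; rewrite ci => /eqP ->.
have [s gs] := SU3_transversal g.
have si : s i = j by apply/eqP; rewrite -ri.
have sk : s k = l by apply/eqP; rewrite -rk.
exists s; split=> // x y.
have [->|yx] := eqVneq y (s x); first exact: gs.
have [xi|xi] := eqVneq x i; first by rewrite xi ri -si -xi (negbTE yx).
have [xk|xk] := eqVneq x k; first by rewrite xk rk -sk -xk (negbTE yx).
have [yj|yj] := eqVneq y j; first by rewrite yj ci (negbTE xi).
have [yl|yl] := eqVneq y l; first by rewrite yl ck (negbTE xk).
have xj : s x != j by rewrite -si (inj_eq perm_inj).
have xl : s x != l by rewrite -sk (inj_eq perm_inj).
exfalso; move: (s x) j l y jl yx yj yl xj xl {si sk gij gkl ri ci rk ck ne}.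
by clear; do 4! apply: forall_ord3.
Qed.

Lemma hatL_meet i j k l : (i, j) <> (k, l) ->
  hatLij i j `&` hatLij k l =
  \bigcup_(s in [set s : 'S_3 | s i = j /\ s k = l]) hatCs s.
Proof.
move=> ne; apply/seteqP; split=> x; have [g ->] := OquotP x.
  move=> [/hatLP gij /hatLP gkl].
  by have [s [si sk gT]] := U2_meet ne gij gkl; exists s => //; apply/hatCP.
move=> [s [<- <-] /hatCP gT]; split; exact/hatLP/T2sub_U2.
Qed.

Lemma weights_all1 t : (forall x y, weight p q a b t x y = 1) -> T2_kernel hpq hab t.
Proof. by move=> h g; apply/T2_isotropyP => x y _. Qed.

(** If t acts nontrivially, the row weights are not all equal, and among three
values that are not all equal one differs from the two others.  Its row can
only meet the column to which a transversal of nonzero entries assigns it. *)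
Lemma singular_U2 t g : ~ T2_kernel hpq hab t -> T2_isotropy hpq hab g t ->
  exists i j, U2 i j g.
Proof.
move=> nk /T2_isotropyP e.
have e' x y : SU3mx g x y != 0 -> left_weight p a t x = right_weight q b t y.
  by move=> gxy; apply/weight_eq1/e.
have [s gs] := SU3_transversal g.
pose al := left_weight p a t.
(* a row whose weight differs from those of the two other rows *)
have [i hi] : exists i, forall x, x != i -> al x != al i.
  apply: contrapT => h; apply: nk; apply: weights_all1 => x y; apply/weight_eq1.
  have -> : right_weight q b t y = al ((s^-1)%g y).
    by rewrite /al (e' _ y) //; have := gs ((s^-1)%g y); rewrite permKV.
  rewrite -/al; apply: contrapT => xy; apply: h.
  move: xy => /eqP; move: x (_ y) => x z.
  case: (eqVneq (al ord0) (al (lift ord0 ord0))) => e01;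
  case: (eqVneq (al ord0) (al (lift ord0 (lift ord0 ord0)))) => e02;
  case: (eqVneq (al (lift ord0 ord0)) (al (lift ord0 (lift ord0 ord0)))) => e12 xz.
  - by exfalso; move: x z xz; do 2! apply: forall_ord3; rewrite ?e01 -?e02 ?e01 ?e12 ?eqxx.
  - by exists ord0; exfalso; move: e12; rewrite -e01 e02 eqxx.
  - by exists ord0; exfalso; move: e02; rewrite e01 e12 eqxx.
  - by exists (lift ord0 (lift ord0 ord0)); apply: forall_ord3.
  - by exists ord0; exfalso; move: e01; rewrite e02 e12 eqxx.
  - by exists (lift ord0 ord0); apply: forall_ord3 => //= _; rewrite // eq_sym.
  - by exists ord0; apply: forall_ord3 => //= _; rewrite eq_sym.
  - by exists ord0; apply: forall_ord3 => //= _; rewrite eq_sym.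
exists i, (s i); apply/U2P => x y xy; apply/eqP; rewrite -[_ == 0]negbK.
apply/negP => gxy; have := e' _ _ gxy; rewrite -/(al x).
have gis := e' _ _ (gs i).
have [xi|xi] := eqVneq x i.
  have ys : y != s i by move: xy; rewrite xi eqxx; case: (y == s i).
  have gy := gs ((s^-1)%g y); rewrite permKV in gy.
  have si : (s^-1)%g y != i by apply: contra ys => /eqP <-; rewrite permKV.
  by have := hi _ si; rewrite xi /al (e' _ _ gy) => /eqP ne /esym.
have -> : y = s i by apply/eqP; move: xy; rewrite (negbTE xi); case: (y == s i).
by rewrite -gis -/(al i) => /eqP; rewrite (negbTE (hi _ xi)).
Qed.

(** G and S collect the strata fixed pointwise by some element that acts
nontrivially.  In a singular point outside the tori all the entries allowed by
its block are nonzero, so whatever fixes it fixes the whole block. *)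
Lemma singular_locus_union :
  exists (G : {set 'I_3 * 'I_3}) (S : {set 'S_3}),
    singular_locus R hpq hab =
      \bigcup_(ij in [set` G]) hatLij ij.1 ij.2 `|` \bigcup_(s in [set` S]) hatCs s.
Proof.
(* pointwise fixed by one element outside the kernel *)
pose fixes (A : set (SU3 R)) := exists2 t, ~ T2_kernel hpq hab t &
  forall g, A g -> T2_isotropy hpq hab g t.
exists [set ij | `[< fixes (U2 ij.1 ij.2) >]]%SET, [set s | `[< fixes (T2sub s) >]]%SET.
have fixS A g : fixes A -> A g -> singular_locus R hpq hab (pt g).
  by move=> [t nk At] Ag; exists g => // sub; apply: nk; apply: sub; exact: At.
apply/seteqP; split=> x.
  move=> [g /= ng <-].
  have [t tg nk] : exists2 t, T2_isotropy hpq hab g t & ~ T2_kernel hpq hab t.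
    by apply: contrapT => h; apply: ng => t tg; apply: contrapT => nk; apply: h; exists t.
  have e := (T2_isotropyP hpq hab t g).1 tg.
  have [[s gs]|ns] := pselect (exists s, T2sub s g).
    right; exists s; last exact/hatCP.
    rewrite /= inE; apply/asboolP; exists t => // h hs.
    by apply/T2_isotropyP => x' y; rewrite hs -gs; exact: e.
  have [i [j gU]] := singular_U2 nk tg; left; exists (i, j); last exact/hatLP.
  rewrite /= inE; apply/asboolP; exists t => // h hU.
  apply/T2_isotropyP => x' y hxy; apply: e.
  move: hxy; have := (U2P h i j).1 hU x' y.
  have [->|xi] := eqVneq x' i; have [->|yj] := eqVneq y j => /=.
  - by rewrite gU.1 eqxx.
  - by move=> /(_ isT) ->; rewrite eqxx.
  - by move=> /(_ isT) ->; rewrite eqxx.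
  - by move=> _ _; apply: U2_block_neq0 gU _ xi yj => s gs; apply: ns; exists s.
have [g ->] := OquotP x.
move=> [[[i j]]|[s]] /=; rewrite inE => /asboolP fA.
  by move=> /hatLP; exact: fixS.
by move=> /hatCP; exact: fixS.
Qed.
End Incidence.

(** * Rules for smooth maps *)

Section SmoothRules.
Context {R : realType} {V : normedModType R}.
Implicit Types f g : V -> R.
Local Notation sm f := (@smooth R V R f).

Lemma smooth_continuous f : sm f -> continuous f.
Proof. by move=> /(_ 0%N). Qed.

Lemma smooth_derivable f x v : sm f -> derivable f x v.
Proof. by move=> /(_ 1%N) /(_ v)[]. Qed.

Lemma smooth_derive f v : sm f -> sm (fun x => 'D_v f x).
Proof. by move=> h k; have [] := h k.+1 v. Qed.

Lemma Ck_cst (c : R) k : @Ck R V R k (fun=> c).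
Proof.
elim: k c => [|k IH] c /=; first by move=> x; exact: cvg_cst.
move=> v; split=> [x|]; first exact: derivable_cst.
rewrite (_ : (fun x => 'D_v (fun=> c) x) = fun=> 0); first exact: IH.
by apply/funext => x; exact: derive_cst.
Qed.

Lemma smooth_cst (c : R) : sm (fun=> c).
Proof. by move=> k; exact: Ck_cst. Qed.

(** Sums preserve each class C^k separately, whereas the Leibniz rule involves
all derivatives of both factors, so products are treated only for smooth maps. *)
Lemma CkD k f g : @Ck R V R k f -> @Ck R V R k g -> @Ck R V R k (fun x => f x + g x).
Proof.
elim: k f g => [|k IH] f g /= hf hg; first by move=> x; apply: cvgD; [exact: hf|exact: hg].
move=> v; have [df cf] := hf v; have [dg cg] := hg v; split=> [x|].
  exact: (derivableD (df x) (dg x)).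
rewrite (_ : (fun x => 'D_v (fun y => f y + g y) x) = fun x => 'D_v f x + 'D_v g x); first exact: IH.
by apply/funext => x; rewrite -(deriveD (df x) (dg x)).
Qed.

Lemma smoothD f g : sm f -> sm g -> sm (fun x => f x + g x).
Proof. by move=> hf hg k; apply: CkD; [exact: hf|exact: hg]. Qed.

Lemma mul_fun_ext f g : (fun x => f x * g x) = f * g.
Proof. exact/funext. Qed.

Lemma smoothM f g : sm f -> sm g -> sm (fun x => f x * g x).
Proof.
move=> hf hg k; elim: k f g hf hg => [|k IH] f g hf hg /=.
  by move=> x; apply: cvgM; exact: smooth_continuous.
move=> v; have df x : derivable f x v by exact: smooth_derivable.
have dg x : derivable g x v by exact: smooth_derivable.
split=> [x|]; first by rewrite mul_fun_ext; exact: derivableM.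
rewrite (_ : (fun x => 'D_v (fun y => f y * g y) x) =
    fun x => f x * 'D_v g x + g x * 'D_v f x).
  by apply: CkD; apply: IH => //; exact: smooth_derive.
by apply/funext => x; rewrite mul_fun_ext deriveM.
Qed.

Lemma smoothN f : sm f -> sm (fun x => - f x).
Proof.
move=> hf; have := smoothM (smooth_cst (-1)) hf.
by under eq_fun do rewrite mulN1r.
Qed.

Lemma smoothB f g : sm f -> sm g -> sm (fun x => f x - g x).
Proof. by move=> hf hg; exact/smoothD/smoothN. Qed.

Lemma continuous_mx (T : topologicalType) m n (M : T -> 'M[R]_(m, n)) :
  (forall i j, continuous (fun x => M x i j)) -> continuous M.
Proof.
move=> h x; apply/cvgrPdist_le => /= e e0.
near=> y; rewrite /Num.Def.normr/= mx_normrE (bigmax_le _ (ltW e0))//= => i _.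
rewrite !mxE/=; move: i; near: y; apply: filter_forall => /= i.
exact: ((cvgrPdist_le _ _).1 (h i.1 i.2 x)).
Unshelve. all: by end_near. Qed.

Lemma smooth_mx n (M : V -> 'rV[R]_n) :
  (forall j, sm (fun x => M x 0 j)) -> smooth M.
Proof.
move=> h k; elim: k M h => [|k IH] M h /=.
  by apply: continuous_mx => i j; rewrite (ord1 i); exact: (h j 0%N).
move=> v; have dM x : derivable M x v.
  by apply/derivable_mxP => i j; rewrite (ord1 i); exact: smooth_derivable.
split=> //; apply: IH => j.
rewrite (_ : (fun x => ('D_v M x) 0 j) = fun x => 'D_v (fun y => M y 0 j) x); first exact: smooth_derive.
by apply/funext => x; rewrite derive_mx // mxE.
Qed.

(** All the maps that are differentiated below are polynomial along lines, so
their directional derivatives are read off as linear coefficients. *)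
Lemma derive_line_poly f (p : {poly R}) x v :
  (forall h : R, f (h *: v + x) = p.[h]) -> 'D_v f x = p^`().[0].
Proof.
move=> e; rewrite -[RHS](@derive_val _ _ _ _ _ _ _ (is_derive_poly p 0)).
rewrite /derive.
suff -> : (fun h : R => h^-1 *: ((f \o shift x) (h *: v) - f x)) =
  (fun h => h^-1 *: ((horner p \o shift 0) (h *: 1) - p.[0])) by [].
apply/funext => h; rewrite /= /shift /= e.
have -> : f x = p.[0] by rewrite -e scale0r add0r.
by rewrite addr0 [h *: 1]mulr1.
Qed.

End SmoothRules.

(** * Complex-valued smooth maps and the determinant *)

Lemma det2 (K : comNzRingType) (A : 'M[K]_2) :
  \det A = A ord0 ord0 * A (lift ord0 ord0) (lift ord0 ord0)
         - A ord0 (lift ord0 ord0) * A (lift ord0 ord0) ord0.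
Proof.
rewrite (expand_det_row _ ord0) !big_ord_recl big_ord0 /cofactor !det_mx11 !mxE /=.
have e0 : lift (lift ord0 ord0) ord0 = ord0 :> 'I_2 by exact: val_inj.
rewrite !(ord1 ord0) ?e0 /bump /=; ring.
Qed.

Lemma det3 (K : comNzRingType) (A : 'M[K]_3) :
  let i0 := ord0 in let i1 := lift ord0 ord0 in let i2 := lift ord0 (lift ord0 ord0) in
  \det A = A i0 i0 * (A i1 i1 * A i2 i2 - A i1 i2 * A i2 i1)
         - A i0 i1 * (A i1 i0 * A i2 i2 - A i1 i2 * A i2 i0)
         + A i0 i2 * (A i1 i0 * A i2 i1 - A i1 i1 * A i2 i0).
Proof.
rewrite /= (expand_det_row _ ord0) !big_ord_recl big_ord0 /cofactor !det2 !mxE /=.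
have e0 : lift (lift ord0 ord0) ord0 = ord0 :> 'I_3 by exact: val_inj.
have e1 : lift (lift ord0 ord0) (lift ord0 ord0) = lift ord0 (lift ord0 ord0) :> 'I_3 by exact: val_inj.
have e2 : lift (lift ord0 (lift ord0 ord0)) ord0 = ord0 :> 'I_3 by exact: val_inj.
have e3 : lift (lift ord0 (lift ord0 ord0)) (lift ord0 ord0) = lift ord0 ord0 :> 'I_3 by exact: val_inj.
rewrite ?e0 ?e1 ?e2 ?e3 /bump /=; ring.
Qed.

(** The trace is the derivative of the determinant at the identity; the higher
coefficients are irrelevant, but must not depend on h. *)
Lemma det_1_add (K : comNzRingType) (Z : 'M[K]_3) : exists c2 c3, forall h : K,
  \det (1%:M + h *: Z) = 1 + h * \tr Z + h ^+ 2 * c2 + h ^+ 3 * c3.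
Proof.
pose i0 : 'I_3 := ord0; pose i1 : 'I_3 := lift ord0 ord0.
pose i2 : 'I_3 := lift ord0 (lift ord0 ord0).
exists ((Z i0 i0 * Z i1 i1 - Z i0 i1 * Z i1 i0) + (Z i0 i0 * Z i2 i2 - Z i0 i2 * Z i2 i0)
   + (Z i1 i1 * Z i2 i2 - Z i1 i2 * Z i2 i1)), (\det Z) => h.
rewrite !det3 !mxE /= !mulr1n !mulr0n /mxtrace !big_ord_recl big_ord0 /i0 /i1 /i2.
ring.
Qed.

Section ComplexMaps.
Context {R : realType} {V : normedModType R}.
Local Notation C := R[i].
Implicit Types f g : V -> C.

Definition csmooth f := @smooth R V R (fun x => complex.Re (f x)) /\
  @smooth R V R (fun x => complex.Im (f x)).

Lemma csmooth_cst (c : C) : csmooth (fun=> c).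
Proof. by split; exact: smooth_cst. Qed.

Lemma csmoothD f g : csmooth f -> csmooth g -> csmooth (fun x => f x + g x).
Proof.
move=> [fr fi] [gr gi]; split.
  rewrite (_ : (fun x => _) = fun x => complex.Re (f x) + complex.Re (g x)).
    exact: smoothD.
  by apply/funext => x; case: (f x) (g x) => ? ? [].
rewrite (_ : (fun x => _) = fun x => complex.Im (f x) + complex.Im (g x)).
  exact: smoothD.
by apply/funext => x; case: (f x) (g x) => ? ? [].
Qed.

Lemma csmoothM f g : csmooth f -> csmooth g -> csmooth (fun x => f x * g x).
Proof.
move=> [fr fi] [gr gi]; split.
  rewrite (_ : (fun x => _) = fun x => complex.Re (f x) * complex.Re (g x)
     - complex.Im (f x) * complex.Im (g x)).
    by apply: smoothB; exact: smoothM.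
  by apply/funext => x; case: (f x) (g x) => ? ? [].
rewrite (_ : (fun x => _) = fun x => complex.Re (f x) * complex.Im (g x)
     + complex.Im (f x) * complex.Re (g x)).
  by apply: smoothD; exact: smoothM.
by apply/funext => x; case: (f x) (g x) => ? ? [].
Qed.

Lemma csmooth_conj f : csmooth f -> csmooth (fun x => (f x)^*).
Proof.
move=> [fr fi]; split.
  by rewrite (_ : (fun x => _) = fun x => complex.Re (f x)) //;
     apply/funext => x; case: (f x).
rewrite (_ : (fun x => _) = fun x => - complex.Im (f x)); first exact: smoothN.
by apply/funext => x; case: (f x).
Qed.

Lemma csmooth_sum (I : Type) (r : seq I) (P : pred I) (F : I -> V -> C) :
  (forall i, csmooth (F i)) -> csmooth (fun x => \sum_(i <- r | P i) F i x).
Proof.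
move=> h; elim: r => [|i r IH].
  by under eq_fun do rewrite big_nil; exact: csmooth_cst.
under eq_fun do rewrite big_cons; case: (P i) => //; exact: csmoothD.
Qed.

Lemma csmooth_prod (I : Type) (r : seq I) (P : pred I) (F : I -> V -> C) :
  (forall i, csmooth (F i)) -> csmooth (fun x => \prod_(i <- r | P i) F i x).
Proof.
move=> h; elim: r => [|i r IH].
  by under eq_fun do rewrite big_nil; exact: csmooth_cst.
under eq_fun do rewrite big_cons; case: (P i) => //; exact: csmoothM.
Qed.

Lemma csmooth_det n (A : V -> 'M[C]_n) :
  (forall k l, csmooth (fun x => A x k l)) -> csmooth (fun x => \det (A x)).
Proof.
move=> h; apply: csmooth_sum => s; apply: csmoothM; first exact: csmooth_cst.
by apply: csmooth_prod => k; exact: h.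
Qed.

Lemma derive_line_cubic (phi : C -> R) f x v c0 c1 c2 c3 :
  {morph phi : z w / z + w} ->
  (forall (h : R) z, phi (h%:C%C * z) = h * phi z) ->
  (forall h : R, f (h *: v + x) = c0 + h%:C%C * c1 + h%:C%C ^+ 2 * c2 + h%:C%C ^+ 3 * c3) ->
  'D_v (fun y => phi (f y)) x = phi c1.
Proof.
move=> phiD phiZ e.
rewrite (@derive_line_poly _ _ _ (Poly [:: phi c0; phi c1; phi c2; phi c3])).
  by rewrite horner_coef0 coef_deriv coef_Poly.
move=> h; rewrite e horner_Poly /= !exprS !expr0 !mulr1 -!mulrA !phiD !phiZ; ring.
Qed.

End ComplexMaps.

(** * Real coordinates on complex matrices of size 3 *)

Section Manifolds.
Variable R : realType.
Local Notation C := R[i].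
Local Notation RV := 'rV[R]_(3 * 3 + 3 * 3).
Implicit Types (g : SU3 R) (A Z : 'M[C]_3) (x y v : RV).

Definition of_real_coords y : 'M[C]_3 :=
  \matrix_(k, l) (vec_mx (lsubmx y) k l +i* vec_mx (rsubmx y) k l)%C.
Local Notation cx := of_real_coords.

Lemma real_coordsK A : cx (real_coords A) = A.
Proof.
apply/matrixP => k l; rewrite mxE /real_coords row_mxKl row_mxKr !mxvecK !mxE.
by case: (A k l).
Qed.

Lemma of_real_coordsK y : real_coords (cx y) = y.
Proof.
rewrite -[RHS]hsubmxK; congr row_mx; apply: (can_inj vec_mxK);
by rewrite mxvecK; apply/matrixP => k l; rewrite !mxE.
Qed.

Lemma of_real_coords_line h v y : cx (h *: v + y) = h%:C%C *: cx v + cx y.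
Proof.
apply/matrixP => k l; rewrite !mxE; apply/eqP; rewrite eq_complex /=.
by rewrite !mul0r subr0 addr0 !eqxx.
Qed.

Lemma smooth_coord (j : 'I_(3 * 3 + 3 * 3)) : @smooth R _ R (fun y : RV => y 0 j).
Proof.
case=> [|k] /=; first exact: coord_continuous.
move=> v.
have e x : is_derive x v (fun y : RV => y 0 j) (v 0 j).
  have D : 'D_v (fun y : RV => y 0 j) x = v 0 j.
    rewrite (@derive_line_poly _ _ _ (Poly [:: x 0 j; v 0 j])).
      by rewrite horner_coef0 coef_deriv coef_Poly.
    by move=> h; rewrite horner_Poly /= !mxE; ring.
  rewrite -D; apply: derivableP.
  by have [] := derivable_mxP (fun y : RV => y) x v; move/(_ (@derivable_id _ _ x v)) => /(_ 0 j).
split=> [x|]; first by have [] := e x.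
rewrite (_ : (fun x => _) = fun=> v 0 j); first exact: Ck_cst.
by apply/funext => x; rewrite (derive_val (is_derive := e x)).
Qed.

Lemma csmooth_entry k l : csmooth (fun y : RV => cx y k l).
Proof.
split; under eq_fun do rewrite !mxE /=; exact: smooth_coord.
Qed.

Definition defect A : 'M[C]_3 := A *m A^t*%sesqui - 1%:M.

Lemma defectE A k l : defect A k l = \sum_m A k m * (A l m)^* - (k == l)%:R.
Proof. by rewrite !mxE; congr (_ - _); apply: eq_bigr => m _; rewrite !mxE. Qed.

Lemma defect_herm A k l : defect A l k = (defect A k l)^*.
Proof.
rewrite !mxE rmorphB rmorph_sum rmorph_nat eq_sym; congr (_ - _).
by apply: eq_bigr => m _; rewrite !mxE rmorphM /= conjCK mulrC.
Qed.

Lemma csmooth_defect k l : csmooth (fun y : RV => defect (cx y) k l).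
Proof.
under eq_fun do rewrite defectE.
apply: csmoothD; last exact: csmooth_cst.
by apply: csmooth_sum => m; apply: csmoothM; [exact: csmooth_entry|apply: csmooth_conj; exact: csmooth_entry].
Qed.

Lemma csmooth_det_coords : csmooth (fun y : RV => \det (cx y)).
Proof. by apply: csmooth_det => k l; exact: csmooth_entry. Qed.

(** For a Hermitian matrix the sums Re + Im of the entries form an arbitrary real
matrix from which it can be recovered: the real part is symmetric and the
imaginary part antisymmetric.  This encodes the Hermitian condition by
exactly nine independent real equations. *)
Definition reim (z : C) : R := complex.Re z + complex.Im z.

Lemma reimD : {morph reim : z w / z + w}.
Proof. by move=> [a b] [c d]; rewrite /reim /=; ring. Qed.
Lemma reimZ (h : R) z : reim (h%:C%C * z) = h * reim z.
Proof. by case: z => a b; rewrite /reim /=; ring. Qed.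
Lemma complex_ReD : {morph @complex.Re R : z w / z + w}.
Proof. by move=> [a b] [c d]. Qed.
Lemma complex_Re_realM (h : R) z : complex.Re (h%:C%C * z) = h * complex.Re z.
Proof. by case: z => a b /=; ring. Qed.
Lemma complex_ImD : {morph @complex.Im R : z w / z + w}.
Proof. by move=> [a b] [c d]. Qed.
Lemma complex_Im_realM (h : R) z : complex.Im (h%:C%C * z) = h * complex.Im z.
Proof. by case: z => a b /=; ring. Qed.

Lemma smooth_reim (f : RV -> C) : csmooth f -> @smooth R _ R (fun y => reim (f y)).
Proof. by move=> [fr fi]; exact: smoothD. Qed.

Lemma reim_herm0 (z : C) : reim z = 0 -> reim z^* = 0 -> z = 0.
Proof.
case: z => a b; rewrite /reim /= => e1 e2.
by apply/eqP; rewrite eq_complex /=; apply/andP; split; apply/eqP; lra.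
Qed.

(** Tangent vectors are written Z A, which turns the differential of A A* into
Z + Z*. *)
Lemma derive_defect A Z k l : A \is unitarymx ->
  'D_(real_coords (Z *m A)) (fun y => reim (defect (cx y) k l)) (real_coords A)
  = reim (Z k l + (Z l k)^*).
Proof.
move=> /unitarymxP hA; pose B := Z *m A.
have e h : defect (cx (h *: real_coords B + real_coords A)) =
    h%:C%C *: (Z + Z^t*%sesqui) + h%:C%C ^+ 2 *: (Z *m Z^t*%sesqui).
  have conjh : (h%:C%C)^* = h%:C%C :> C by apply/eqP; rewrite eq_complex /= oppr0 !eqxx.
  rewrite of_real_coords_line !real_coordsK /defect.
  have -> : (h%:C%C *: B + A)^t*%sesqui = h%:C%C *: (A^t*%sesqui *m Z^t*%sesqui) + A^t*%sesqui.
    rewrite /B linearP /= map_mxD map_mxZ /= conjh; congr (_ *: _ + _).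
    by rewrite trmx_mul map_mxM.
  have e1 (N : 'M[C]_3) : A *m (A^t*%sesqui *m N) = N by rewrite mulmxA hA mul1mx.
  rewrite mulmxDl !mulmxDr -!scalemxAl -!scalemxAr /B -!mulmxA !e1 hA mulmx1.
  by rewrite addrA addrK scalerA -expr2 scalerDr -addrA addrC.
rewrite (derive_line_cubic (c0 := 0) (c1 := Z k l + (Z l k)^*)
   (c2 := (Z *m Z^t*%sesqui) k l) (c3 := 0) reimD reimZ) // => h.
by rewrite -/B e !mxE mulr0 addr0 add0r.
Qed.

Lemma derive_Im_det A Z : \det A = 1 ->
  'D_(real_coords (Z *m A)) (fun y => complex.Im (\det (cx y))) (real_coords A)
  = complex.Im (\tr Z).
Proof.
move=> dA; have [c2 [c3 e]] := det_1_add Z.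
rewrite (derive_line_cubic (c0 := 1) (c1 := \tr Z) (c2 := c2) (c3 := c3) complex_ImD complex_Im_realM) // => h.
rewrite of_real_coords_line !real_coordsK -{2}[A]mul1mx scalemxAl -mulmxDl det_mulmx dA mulr1.
by rewrite addrC e.
Qed.

Lemma derive_entry (phi : C -> R) v y k l :
  {morph phi : z w / z + w} -> (forall (h : R) z, phi (h%:C%C * z) = h * phi z) ->
  'D_v (fun y => phi (cx y k l)) y = phi (cx v k l).
Proof.
move=> phiD phiZ.
rewrite (derive_line_cubic (c0 := cx y k l) (c1 := cx v k l) (c2 := 0) (c3 := 0) phiD phiZ) // => h.
by rewrite of_real_coords_line [LHS]mxE [X in X + _]mxE !mulr0 !addr0 addrC.
Qed.

(** A unitary matrix has a determinant of modulus 1; if that determinant is real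
and close to 1, it is 1.  So the real equation Im det = 0 cuts SU(3) out of U(3)
locally. *)
Lemma near_det_eq1 A : \det A = 1 ->
  \forall y \near real_coords A, cx y \is unitarymx ->
    complex.Im (\det (cx y)) = 0 -> \det (cx y) = 1.
Proof.
move=> dA; have [sr _] := csmooth_det_coords.
have c := smooth_continuous sr (x := real_coords A).
have H : \forall z \near complex.Re (\det (cx (real_coords A))), (0 : R) < z.
  by apply: lt_nbhsr; rewrite real_coordsK dA ltr01.
have P : \forall y \near real_coords A, (0 : R) < complex.Re (\det (cx y)).
  exact: c H.
apply: filterS P => y pos uy im0.
have n1 : `|\det (cx y)| ^+ 2 = 1.
  have := congr1 determinant (unitarymxP uy).
  by rewrite det_mulmx det_map_mx det_tr det1 normCK.
move: n1 pos im0; case: (\det (cx y)) => u w /= n1 u0 w0; subst w.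
have : u ^+ 2 = 1.
  move: n1; rewrite normCK => /(congr1 (@complex.Re R)) /= e.
  by rewrite expr2; lra.
move/eqP; rewrite sqrf_eq1 => /orP[/eqP -> //|/eqP e].
by exfalso; have u0' : (0 : R) < u := u0; move: u0'; rewrite e; lra.
Qed.
End Manifolds.

(** * SU(3) and its blocks as submanifolds *)

Lemma derive_rV (R : realType) (V : normedModType R) n (F : V -> 'rV[R]_n) x v (u : 'rV[R]_n) :
  smooth F -> (forall j, 'D_v (fun y => F y 0 j) x = u 0 j) -> 'D_v F x = u.
Proof.
move=> sF h; have [dF _] := sF 1%N v.
by apply/rowP => j; rewrite derive_mx // mxE h.
Qed.

Section Manifolds.
Variable R : realType.
Local Notation C := R[i].
Local Notation RV := 'rV[R]_(3 * 3 + 3 * 3).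
Implicit Types (g : SU3 R) (A Z : 'M[C]_3) (x y v : RV).
Local Notation cx := of_real_coords.

(** Half of the Hermitian matrix encoded by U determines Z + Z*; it has a real
trace, so that the multiple i s / 3 of the identity, which is invisible in
Z + Z*, can be used to adjust Im tr Z. *)
Definition herm_half (U : 'M[R]_3) (s : R) : 'M[C]_3 :=
  \matrix_(k, l) (((U k l + U l k) / 4 +i* ((U k l - U l k) / 4 + (k == l)%:R * s / 3)))%C.

Lemma herm_half_reim U s k l :
  reim (herm_half U s k l + (herm_half U s l k)^*) = U k l.
Proof. by rewrite !mxE /reim /= [l == k]eq_sym; lra. Qed.

Lemma herm_half_tr U s : complex.Im (\tr (herm_half U s)) = s.
Proof.
rewrite /mxtrace !big_ord_recl big_ord0 !mxE /=  ?subrr ?mul0r ?mul1r; lra.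
Qed.

Lemma SU3_image y : ((@real_coords R \o @SU3mx R) @` [set: SU3 R]) y <->
  cx y \is unitarymx /\ \det (cx y) = 1.
Proof.
split=> [[g _ <-] /=|[uy dy]].
  by rewrite real_coordsK; split; [exact: SU3_unitary|exact: SU3_det].
by have [g gE] := exists_SU3 uy dy; exists g; rewrite //= gE of_real_coordsK.
Qed.

Lemma unitary_defect A : A \is unitarymx <-> defect A = 0.
Proof.
split=> [/unitarymxP e|/eqP]; first by rewrite /defect e subrr.
by rewrite subr_eq0 => /eqP e; apply/unitarymxP.
Qed.

Definition SU3_eqs y : 'rV[R]_(3 * 3 + 1) :=
  row_mx (mxvec (\matrix_(k, l) reim (defect (cx y) k l)))
         (\row_(_ < 1) complex.Im (\det (cx y))).

Lemma SU3_eqs_l y k l : SU3_eqs y 0 (lshift 1 (mxvec_index k l)) = reim (defect (cx y) k l).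
Proof. by rewrite row_mxEl mxvecE mxE. Qed.

Lemma SU3_eqs_r y k : SU3_eqs y 0 (rshift (3 * 3) k) = complex.Im (\det (cx y)).
Proof. by rewrite row_mxEr mxE. Qed.

Lemma SU3_eqs0 y : SU3_eqs y = 0 <->
  (forall k l, reim (defect (cx y) k l) = 0) /\ complex.Im (\det (cx y)) = 0.
Proof.
split=> [/rowP e|[e1 e2]].
  split=> [k l|]; first by rewrite -SU3_eqs_l e mxE.
  by rewrite -(SU3_eqs_r y 0) e mxE.
apply/rowP => j; rewrite [RHS]mxE; case: (split_ordP j) => k ->.
  by case/mxvec_indexP: k => k l; rewrite SU3_eqs_l.
by rewrite SU3_eqs_r.
Qed.

Lemma smooth_SU3_eqs : smooth SU3_eqs.
Proof.
apply: smooth_mx => j; case: (split_ordP j) => k ->.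
  case/mxvec_indexP: k => k l; under eq_fun do rewrite SU3_eqs_l.
  exact/smooth_reim/csmooth_defect.
by under eq_fun do rewrite SU3_eqs_r; have [] := @csmooth_det_coords R.
Qed.

Lemma SU3_eqs_regular A u : A \is unitarymx -> \det A = 1 ->
  exists v, 'D_v SU3_eqs (real_coords A) = u.
Proof.
move=> hA dA; pose Z := herm_half (vec_mx (lsubmx u)) (rsubmx u 0 0).
exists (real_coords (Z *m A)); apply: derive_rV; first exact: smooth_SU3_eqs.
move=> j; case: (split_ordP j) => k ->.
  case/mxvec_indexP: k => k l; under eq_fun do rewrite SU3_eqs_l.
  by rewrite derive_defect // herm_half_reim !mxE.
under eq_fun do rewrite SU3_eqs_r.
by rewrite derive_Im_det // herm_half_tr !mxE (ord1 k).
Qed.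

Lemma SU3_submanifold :
  @submanifold R (3 * 3 + 3 * 3) (6 + 2) ((@real_coords R \o @SU3mx R) @` [set: SU3 R]).
Proof.
split=> // x /SU3_image[ux dx]; exists SU3_eqs; split; first exact: smooth_SU3_eqs.
  by move=> u; rewrite -(of_real_coordsK x); exact: SU3_eqs_regular.
have := near_det_eq1 dx; rewrite of_real_coordsK; apply: filterS => y dy.
split=> [/SU3_image[uy dety]|/SU3_eqs0[S0 D0]].
  apply/SU3_eqs0; rewrite (unitary_defect _).1 // dety; split=> // k l.
  by rewrite mxE /reim /= addr0.
have uy : cx y \is unitarymx.
  apply/unitary_defect/matrixP => k l; rewrite [RHS]mxE; apply: reim_herm0 => //.
  by rewrite -defect_herm.
by apply/SU3_image; split=> //; exact: dy.
Qed.

Lemma lift_eqF n (i : 'I_n) m : (lift i m == i) = false.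
Proof. by rewrite eq_sym (negbTE (neq_lift _ _)). Qed.

Section Block.
Variables i j : 'I_3.

Lemma U2_image y : ((@real_coords R \o @SU3mx R) @` (@U2 R i j)) y <->
  [/\ cx y \is unitarymx, \det (cx y) = 1 &
      forall k l, (k == i) != (l == j) -> cx y k l = 0].
Proof.
split=> [[g /U2P gU <-] /=|[uy dy h]].
  by rewrite real_coordsK; split; [exact: SU3_unitary|exact: SU3_det|].
have [g gE] := exists_SU3 uy dy; exists g; last by rewrite /= gE of_real_coordsK.
by apply/U2P; rewrite gE.
Qed.

(** Thirteen equations for the block together with Im det = 0.  A pair of rows
that are both equal to or both different from i carries one of the five
Hermitian equations.  The other four slots of the matrix hold the real parts of
the four off-block entries, to which tperm i j matches them; the imaginary parts
follow, row by row and column by column. *)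
Definition U2_eqs y : 'rV[R]_(3 * 3 + (2 + (2 + 1))) :=
  row_mx (mxvec (\matrix_(k, l) (if (k == i) == (l == i) then reim (defect (cx y) k l)
                                 else complex.Re (cx y k (tperm i j l)))))
  (row_mx (\row_m complex.Im (cx y i (lift j m)))
  (row_mx (\row_m complex.Im (cx y (lift i m) j))
          (\row_(_ < 1) complex.Im (\det (cx y))))).

(** Named positions spare nested splits of the index of an equation. *)
Definition eq_ix_mx k l : 'I_(3 * 3 + (2 + (2 + 1))) := lshift _ (mxvec_index k l).
Definition eq_ix_row m : 'I_(3 * 3 + (2 + (2 + 1))) := rshift _ (lshift _ m).
Definition eq_ix_col m : 'I_(3 * 3 + (2 + (2 + 1))) := rshift _ (rshift _ (lshift _ m)).
Definition eq_ix_det : 'I_(3 * 3 + (2 + (2 + 1))) := rshift _ (rshift _ (rshift _ ord0)).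

Lemma eq_ixP (P : 'I_(3 * 3 + (2 + (2 + 1))) -> Prop) :
  (forall k l, P (eq_ix_mx k l)) -> (forall m, P (eq_ix_row m)) ->
  (forall m, P (eq_ix_col m)) -> P eq_ix_det -> forall n, P n.
Proof.
move=> h1 h2 h3 h4 n; case: (split_ordP n) => [m ->|m ->].
  by case/mxvec_indexP: m => k l; exact: h1.
case: (split_ordP m) => [m' ->|m' ->]; first exact: h2.
by case: (split_ordP m') => m'' ->; [exact: h3|rewrite (ord1 m'')].
Qed.

Lemma U2_eqs_mx y k l : U2_eqs y 0 (eq_ix_mx k l) =
  if (k == i) == (l == i) then reim (defect (cx y) k l)
  else complex.Re (cx y k (tperm i j l)).
Proof. by rewrite row_mxEl mxvecE mxE. Qed.

Lemma U2_eqs_row y m : U2_eqs y 0 (eq_ix_row m) = complex.Im (cx y i (lift j m)).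
Proof. by rewrite row_mxEr row_mxEl mxE. Qed.

Lemma U2_eqs_col y m : U2_eqs y 0 (eq_ix_col m) = complex.Im (cx y (lift i m) j).
Proof. by rewrite row_mxEr row_mxEr row_mxEl mxE. Qed.

Lemma U2_eqs_det y : U2_eqs y 0 eq_ix_det = complex.Im (\det (cx y)).
Proof. by rewrite row_mxEr row_mxEr row_mxEr mxE. Qed.

Lemma smooth_U2_eqs : smooth U2_eqs.
Proof.
apply: smooth_mx; apply: eq_ixP => [k l|m|m|].
- under eq_fun do rewrite U2_eqs_mx; case: (_ == _).
    exact/smooth_reim/csmooth_defect.
  by have [] := @csmooth_entry R k (tperm i j l).
- by under eq_fun do rewrite U2_eqs_row; have [] := @csmooth_entry R i (lift j m).
- by under eq_fun do rewrite U2_eqs_col; have [] := @csmooth_entry R (lift i m) j.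
- by under eq_fun do rewrite U2_eqs_det; have [] := @csmooth_det_coords R.
Qed.

Lemma tperm_eq l : (tperm i j l == j) = (l == i).
Proof.
apply/eqP/eqP=> [e|->]; last exact: tpermL.
by apply: (@perm_inj _ (tperm i j)); rewrite e tpermL.
Qed.

(** Take the tangent vector X A + Y, with X a Hermitian half supported on the
diagonal blocks and Y supported off the block.  As A is block-shaped, Y A* has
no diagonal block, so the Hermitian equations and the trace see only X while
the off-block entries see only Y. *)
Lemma U2_eqs_regular A u : A \is unitarymx -> \det A = 1 ->
  (forall k l, (k == i) != (l == j) -> A k l = 0) ->
  exists v, 'D_v U2_eqs (real_coords A) = u.
Proof.
move=> hA dA A0.
pose H := herm_half (\matrix_(k, l) u 0 (eq_ix_mx k l)) (u 0 eq_ix_det).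
pose X : 'M[C]_3 := \matrix_(k, l) (if (k == i) == (l == i) then H k l else 0).
pose w k m := if k == i then (if unlift j m is Some m' then u 0 (eq_ix_row m') else 0)
              else (if unlift i k is Some k' then u 0 (eq_ix_col k') else 0).
pose Y : 'M[C]_3 := \matrix_(k, m) (if (k == i) != (m == j)
                     then (u 0 (eq_ix_mx k (tperm i j m)) +i* w k m)%C else 0).
pose Z := X + Y *m A^t*%sesqui.
have ZA : Z *m A = X *m A + Y.
  by rewrite mulmxDl -mulmxA (mulmx1C (unitarymxP hA)) mulmx1.
have Zin k l : (k == i) == (l == i) -> Z k l = H k l.
  move=> kl; rewrite !mxE kl big1 ?addr0 // => m _; rewrite !mxE.
  case: ifP; rewrite ?mul0r // => km; rewrite A0 ?rmorph0 ?mulr0 //.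
  by rewrite -(eqP kl).
have Vout k l : (k == i) != (l == j) -> (Z *m A) k l = Y k l.
  move=> kl; rewrite ZA [LHS]mxE [X in X + _]mxE big1 ?add0r // => m _.
  rewrite [X k m]mxE; case: ifP => [km|]; last by rewrite mul0r.
  by rewrite A0 ?mulr0 // -(eqP km).
exists (real_coords (Z *m A)); apply: derive_rV; first exact: smooth_U2_eqs.
apply: eq_ixP => [k l|m|m|].
- under eq_fun do rewrite U2_eqs_mx; case kl: ((k == i) == (l == i)).
    rewrite derive_defect // !Zin // ?herm_half_reim ?mxE //.
    by rewrite eq_sym.
  rewrite (derive_entry _ _ _ _ (@complex_ReD R) (@complex_Re_realM R)) real_coordsK.
  rewrite Vout; last by rewrite tperm_eq kl.
  by rewrite mxE tperm_eq kl /= tpermK.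
- under eq_fun do rewrite U2_eqs_row.
  rewrite (derive_entry _ _ _ _ (@complex_ImD R) (@complex_Im_realM R)) real_coordsK.
  rewrite Vout; last by rewrite eqxx lift_eqF.
  by rewrite mxE eqxx lift_eqF /= /w eqxx liftK.
- under eq_fun do rewrite U2_eqs_col.
  rewrite (derive_entry _ _ _ _ (@complex_ImD R) (@complex_Im_realM R)) real_coordsK.
  rewrite Vout; last by rewrite eqxx lift_eqF.
  by rewrite mxE eqxx lift_eqF /= /w lift_eqF liftK.
under eq_fun do rewrite U2_eqs_det.
rewrite derive_Im_det // (_ : \tr Z = \tr H) ?herm_half_tr //.
by apply: eq_bigr => k _; rewrite Zin.
Qed.

Lemma U2_submanifold :
  @submanifold R (3 * 3 + 3 * 3) (2 + 2) ((@real_coords R \o @SU3mx R) @` (@U2 R i j)).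
Proof.
split=> // x /U2_image[ux dx x0]; exists U2_eqs; split; first exact: smooth_U2_eqs.
  by move=> u; rewrite -(of_real_coordsK x); exact: U2_eqs_regular.
have := near_det_eq1 dx; rewrite of_real_coordsK; apply: filterS => y dy.
split=> [/U2_image[uy dety y0]|/rowP e].
  have d0 := (unitary_defect _).1 uy.
  apply/rowP => n; rewrite [RHS]mxE; move: n; apply: eq_ixP => [k l|m|m|].
  - rewrite U2_eqs_mx d0; case: ifP => kl; first by rewrite mxE /reim /= addr0.
    by rewrite y0 // tperm_eq kl.
  - by rewrite U2_eqs_row y0 // eqxx lift_eqF.
  - by rewrite U2_eqs_col y0 // eqxx lift_eqF.
  - by rewrite U2_eqs_det dety.
have y0 k l : (k == i) != (l == j) -> cx y k l = 0.
  move=> kl; apply/eqP; rewrite eq_complex; apply/andP; split; apply/eqP.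
    have := e (eq_ix_mx k (tperm i j l)); rewrite U2_eqs_mx -(tperm_eq (tperm i j l)) tpermK (negbTE kl).
    by rewrite [RHS]mxE.
  move: kl; case: (unliftP i k) => [k' ->|->]; case: (unliftP j l) => [l' ->|->];
    rewrite ?eqxx ?lift_eqF //= => _.
    by rewrite -U2_eqs_col e mxE.
  by rewrite -U2_eqs_row e mxE.
have uy : cx y \is unitarymx.
  apply/unitary_defect/matrixP => k l; rewrite [RHS]mxE.
  have [kl|kl] := boolP ((k == i) == (l == i)).
    apply: reim_herm0; rewrite -?defect_herm.
      by have := e (eq_ix_mx k l); rewrite U2_eqs_mx kl [RHS]mxE.
    by have := e (eq_ix_mx l k); rewrite U2_eqs_mx eq_sym kl [RHS]mxE.
  have kl' : k != l by apply: contraNneq kl => ->.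
  rewrite defectE (negbTE kl') subr0 big1 // => m _.
  have [km|km] := boolP ((k == i) == (m == j)); last by rewrite y0 // mul0r.
  by rewrite [cx y l m]y0 ?rmorph0 ?mulr0 // -(eqP km) eq_sym.
apply/U2_image; split=> //; apply: dy => //.
by have := e eq_ix_det; rewrite U2_eqs_det mxE.
Qed.
End Block.

End Manifolds.

(** * Compactness of the blocks and complex-valued limits *)

Section Compactness.
Variable R : realType.
Local Notation C := R[i].
Local Notation RV := 'rV[R]_(3 * 3 + 3 * 3).
Local Notation cx := of_real_coords.
Local Notation rc := (@real_coords R \o @SU3mx R).

Lemma continuous_SU3_coords : continuous (rc : SU3 R -> RV).
Proof. exact: initial_continuous. Qed.

Lemma closed_forall (T : topologicalType) (I : Type) (P : I -> T -> Prop) :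
  (forall i, closed [set x | P i x]) -> closed [set x | forall i, P i x].
Proof.
move=> h; have := @closed_bigI T I setT (fun i => [set x | P i x]) (fun i _ => h i).
congr closed; apply/seteqP; split=> x /= hx i; first exact: hx.
by move=> _; exact: hx.
Qed.

Lemma closed_level (f : RV -> R) c : continuous f -> closed [set y | f y = c].
Proof.
by move=> cf; apply: (@closed_comp _ _ f [set c]) => [y _|]; [exact: cf|exact: closed_eq].
Qed.

Lemma closed_complex_level (f : RV -> C) c : csmooth f -> closed [set y | f y = c].
Proof.
move=> [/smooth_continuous fr /smooth_continuous fi].
have -> : [set y | f y = c] =
    [set y | complex.Re (f y) = complex.Re c] `&` [set y | complex.Im (f y) = complex.Im c].
  apply/seteqP; split=> y /= => [->//|[e1 e2]].
  by apply/eqP; rewrite eq_complex e1 e2 !eqxx.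
by apply: closedI; exact: closed_level.
Qed.

Lemma closed_U2_coords i j : closed (rc @` @U2 R i j).
Proof.
have -> : rc @` @U2 R i j = [set y : RV | forall k l, defect (cx y) k l = 0] `&`
    [set y : RV | \det (cx y) = 1] `&`
    [set y : RV | forall kl : 'I_3 * 'I_3, (kl.1 == i) != (kl.2 == j) -> cx y kl.1 kl.2 = 0].
  apply/seteqP; split=> y.
    move=> /U2_image[uy dy y0]; split; last by move=> [k l]; exact: y0.
    by split=> // k l; rewrite (unitary_defect _).1 // mxE.
  move=> [[/= e d] y0]; apply/U2_image; split=> //; last by move=> k l; exact: (y0 (k, l)).
  by apply/unitary_defect/matrixP => k l; rewrite e mxE.
apply: closedI; first apply: closedI.
- do 2! apply: closed_forall => ?; exact/closed_complex_level/csmooth_defect.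
- exact/closed_complex_level/csmooth_det_coords.
- apply: closed_forall => -[k l] /=; case: (_ != _).
    rewrite (_ : mkset _ = [set y : RV | cx y k l = 0]).
      exact/closed_complex_level/csmooth_entry.
    by apply/seteqP; split=> y /= h //; exact: h.
  rewrite (_ : mkset _ = setT); first exact: closedT.
  by apply/seteqP; split.
Qed.

Lemma SU3_entry_le1 g k l : `|SU3mx g k l| <= 1 :> C.
Proof.
have := SU3_rows g k k; rewrite eqxx (bigD1 l) //= -normCK => e.
rewrite -(@expr_le1 _ 2) // -[leRHS]/(true%:R) -e lerDl sumr_ge0 // => m _.
by rewrite -normCK exprn_ge0.
Qed.

Lemma bounded_U2_coords i j : bounded_set (rc @` @U2 R i j).
Proof.
exists 1; split=> // M M1 _ [g _ <-].
rewrite /Num.Def.normr /= mx_normrE (bigmax_le _ (le_trans ler01 (ltW M1))) //= => -[x y] _.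
apply: le_trans (ltW M1); rewrite (ord1 x) /= /real_coords.
have e k l := SU3_entry_le1 g k l.
have e' k l : `|complex.Re (SU3mx g k l)| <= 1 /\ `|complex.Im (SU3mx g k l)| <= 1.
  have := e k l; case: (SU3mx g k l) => u v; rewrite normc_def /= lecR => h.
  have h' : u ^+ 2 + v ^+ 2 <= 1.
    rewrite -(@sqr_sqrtr _ (u ^+ 2 + v ^+ 2)) ?addr_ge0 ?sqr_ge0 //.
    by rewrite expr_le1 // sqrtr_ge0.
  by split; rewrite -(@expr_le1 _ 2) // real_normK ?num_real //; nra.
case: (split_ordP y) => m ->; case/mxvec_indexP: m => k l.
  by rewrite row_mxEl mxvecE mxE; case: (e' k l).
by rewrite row_mxEr mxvecE mxE; case: (e' k l).
Qed.

(** The coordinate image is closed and bounded; compactness is pulled back along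
the coordinate map, which defines the topology of SU(3). *)
Lemma compact_U2 i j : compact (@U2 R i j : set (SU3 R)).
Proof.
have K : compact (rc @` @U2 R i j).
  by apply: bounded_closed_compact; [exact: bounded_U2_coords|exact: closed_U2_coords].
have im (F : set_system (SU3 R)) (A : set (SU3 R)) : Filter F -> F A ->
    F (rc @^-1` (rc @` A)).
  by move=> FF; apply: filterS => g Ag; exists g.
move=> F PF FU; have [|y [[g gU gy] cl]] := K (rc @ F); first exact: im.
exists g; split=> // A B FA; rewrite nbhsE => -[D0 [[D oD DO] Og] OB].
have [||_ [[h hA <-] Dh]] := cl (rc @` A) D; first exact: im.
  by rewrite -gy; apply: open_nbhs_nbhs; split=> //; move: Og; rewrite -DO.
by exists h; split=> //; apply: OB; rewrite -DO.
Qed.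
End Compactness.

Section ComplexContinuity.
Variable R : realType.
Local Notation C := R[i].
Variable T : topologicalType.
Implicit Types f g : T -> C.

(** Continuity of a complex-valued function at a point, through its real and
imaginary parts. *)
Definition ccvg f x := (complex.Re (f y) @[y --> x] --> complex.Re (f x)) /\
  (complex.Im (f y) @[y --> x] --> complex.Im (f x)).

Lemma ccvg_cst c x : ccvg (fun=> c) x.
Proof. by split; exact: cvg_cst. Qed.

Lemma ccvgM f g x : ccvg f x -> ccvg g x -> ccvg (fun y => f y * g y) x.
Proof.
have reM (z w : C) : complex.Re (z * w) =
  complex.Re z * complex.Re w - complex.Im z * complex.Im w by case: z w => ? ? [].
have imM (z w : C) : complex.Im (z * w) =
  complex.Re z * complex.Im w + complex.Im z * complex.Re w by case: z w => ? ? [].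
move=> [fr fi] [gr gi]; split.
  by under eq_fun do rewrite reM; rewrite reM; apply: cvgB; exact: cvgM.
by under eq_fun do rewrite imM; rewrite imM; apply: cvgD; exact: cvgM.
Qed.

Lemma ccvg_conj f x : ccvg f x -> ccvg (fun y => (f y)^*) x.
Proof.
have reC (z : C) : complex.Re z^* = complex.Re z by case: z.
have imC (z : C) : complex.Im z^* = - complex.Im z by case: z.
move=> [fr fi]; split; first by under eq_fun do rewrite reC; rewrite reC.
by under eq_fun do rewrite imC; rewrite imC; exact: cvgN.
Qed.

Lemma ccvg_real (r : T -> R) x : r y @[y --> x] --> r x -> ccvg (fun y => (r y)%:C%C) x.
Proof. by split=> //=; exact: cvg_cst. Qed.

Lemma ccvg_norm f x : ccvg f x -> ccvg (fun y => `|f y|) x.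
Proof.
move=> [fr fi]; have e (z : C) : `|z| = (Num.sqrt (complex.Re z ^+ 2 + complex.Im z ^+ 2))%:C%C.
  by case: z => u v; rewrite normc_def.
under eq_fun do rewrite e; apply: ccvg_real.
apply: continuous_cvg; first exact: sqrt_continuous.
by apply: cvgD; rewrite !expr2; under eq_fun do rewrite expr2; exact: cvgM.
Qed.

Lemma ccvgV f x : f x != 0 -> ccvg f x -> ccvg (fun y => (f y)^-1) x.
Proof.
move=> f0 hf; have e (z : C) : z^-1 = z^* *
    ((complex.Re z * complex.Re z + complex.Im z * complex.Im z)^-1)%:C%C.
  case: z => u v; apply/eqP; rewrite eq_complex /= !expr2 !mulr0 subr0 add0r.
  by rewrite mulNr !eqxx.
under eq_fun do rewrite e; apply: ccvgM; first exact: ccvg_conj.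
have [fr fi] := hf; apply: ccvg_real; apply: cvgV.
  move: f0; apply: contra_neq; case: (f x) => u v /= h.
  have : u = 0 /\ v = 0 by split; nra.
  by case=> -> ->.
by apply: cvgD; exact: cvgM.
Qed.

Lemma ccvgXz f (n : int) x : f x != 0 -> ccvg f x -> ccvg (fun y => f y ^ n) x.
Proof.
have X (m : nat) h : ccvg h x -> ccvg (fun y => h y ^+ m) x.
  move=> hh; elim: m => [|m IH]; first exact: ccvg_cst.
  by under eq_fun do rewrite exprS; exact: ccvgM.
move=> f0 hf; case: n => n; first exact: X.
apply: ccvgV; last exact: X.
by rewrite expf_neq0.
Qed.

Lemma ccvg_squeeze f g x : f x = 0 -> g x = 0 -> (forall y, `|f y| <= `|g y|) ->
  ccvg g x -> ccvg f x.
Proof.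
move=> f0 g0 fg /ccvg_norm[gr _].
have le y : `|complex.Re (f y)| <= complex.Re `|g y| /\ `|complex.Im (f y)| <= complex.Re `|g y|.
  have := fg y; rewrite [`|g y|]normc_def /= [`|f y|]normc_def lecR; case: (f y) => u v /=.
  move=> h; split; apply: le_trans h; rewrite -sqrtr_sqr ler_sqrt ?addr_ge0 ?sqr_ge0 //.
    by rewrite lerDl sqr_ge0.
  by rewrite lerDr sqr_ge0.
rewrite g0 normr0 /= in gr.
split; rewrite f0 /=; apply/cvgrPdist_lt => e e0;
  move/cvgrPdist_lt: gr => /(_ _ e0); apply: filterS => y; rewrite !sub0r !normrN => h;
  apply: le_lt_trans h; have [le1 le2] := le y.
  exact: le_trans le1 (ler_norm _).
exact: le_trans le2 (ler_norm _).
Qed.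
End ComplexContinuity.

(** * Norm-preserving powers and explicit block matrices *)

(** The n-th power of the phase of u, with the modulus of u: keeping the modulus
makes it continuous at 0 for every n, including negative n. *)
HB.lock Definition phase_pow (K : numClosedFieldType) (u : K) (n : int) : K :=
  `|u| * (u / `|u|) ^ n.

Section PhasePower.
Variable K : numClosedFieldType.
Implicit Types u v s : K.

Lemma phase_powM s u n : `|s| = 1 -> phase_pow (s * u) n = s ^ n * phase_pow u n.
Proof. by move=> s1; rewrite phase_pow.unlock normrM s1 mul1r -mulrA expfzMl mulrCA. Qed.

Lemma norm_phase_pow u n : `|phase_pow u n| = `|u|.
Proof.
have [->|u0] := eqVneq u 0; first by rewrite phase_pow.unlock !normr0 mul0r normr0.
rewrite phase_pow.unlock normrM normr_id norm1_exp ?mulr1 //.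
by rewrite normf_div normr_id divff // normr_eq0.
Qed.

Lemma phase_pow_ge0 u n : 0 <= u -> phase_pow u n = u.
Proof.
move=> u0; rewrite phase_pow.unlock ger0_norm //.
have [->|un0] := eqVneq u 0; first by rewrite mul0r.
by rewrite divff // exp1rz mulr1.
Qed.

(** When both numbers vanish the phase is arbitrary. *)
Lemma norm_eq_phase u v : `|u| = `|v| -> exists s, `|s| = 1 /\ v = s * u.
Proof.
have [->|u0] := eqVneq u 0.
  rewrite normr0 => /esym/eqP; rewrite normr_eq0 => /eqP ->.
  by exists 1; rewrite normr1 mulr0.
move=> uv; exists (v / u); rewrite normf_div -uv divff ?normr_eq0 //.
by rewrite divfK.
Qed.
End PhasePower.

(** At a zero of f the modulus squeezes the power to 0; elsewhere the defining
formula is continuous. *)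
Lemma ccvg_phase_pow (R : realType) (T : topologicalType) (f : T -> R[i]) n x :
  ccvg f x -> ccvg (fun y => phase_pow (f y) n) x.
Proof.
move=> hf; have [f0|f0] := eqVneq (f x) 0.
  apply: (ccvg_squeeze _ f0 _ hf); first by rewrite f0 phase_pow_ge0.
  by move=> y; rewrite norm_phase_pow.
have nf : ccvg (fun y => `|f y|) x by exact: ccvg_norm.
rewrite phase_pow.unlock; apply: ccvgM => //; apply: ccvgXz; first by rewrite mulf_neq0 ?invr_eq0 ?normr_eq0.
by apply: ccvgM => //; apply: ccvgV; rewrite ?normr_eq0.
Qed.

Section BlockEmbedding.
Variable R : realType.
Local Notation C := R[i].
Variables i j : 'I_3.

(** The corner is the sign of its own cofactor, so that the determinant equals
that of the 2 x 2 part. *)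
Definition embed_block (al ga : C) : 'M[C]_3 := \matrix_(x, y)
  match unlift i x, unlift j y with
  | None, None => (-1) ^+ (i + j)
  | Some x', Some y' => if x' == ord0 then (if y' == ord0 then al else - ga^*)
                        else (if y' == ord0 then ga else al^*)
  | _, _ => 0
  end.

Lemma sum_lift n (k : 'I_n.+1) (F : 'I_n.+1 -> C) :
  \sum_m F m = F k + \sum_m F (lift k m).
Proof. by rewrite (bigD1_ord k). Qed.

Lemma embed_block_unitary al ga : `|al| ^+ 2 + `|ga| ^+ 2 = 1 ->
  embed_block al ga \is unitarymx.
Proof.
rewrite !normCK => e; apply/unitarymxP/matrixP => x y; rewrite !mxE (sum_lift j).
rewrite !big_ord_recl big_ord0 !mxE unlift_none !liftK /=.
case: (unliftP i x) => [x' ->|->]; case: (unliftP i y) => [y' ->|->].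
- rewrite (inj_eq lift_inj).
  have [->|x0] := eqVneq x' ord0.
    have [_|y0] := eqVneq y' ord0; rewrite mul0r add0r addr0 ?rmorphN /= conjCK.
      rewrite -[RHS]e; ring.
    rewrite -[RHS]/0; ring.
  have [->|y0] := eqVneq y' ord0; rewrite mul0r add0r addr0 ?rmorphN /= conjCK.
    rewrite (negbTE x0) -[RHS]/0; ring.
  have -> : x' = y'.
    by move: x' y' x0 y0 => [[|[|//]] ?] [[|[|//]] ?] // _ _; exact: val_inj.
  rewrite eqxx -[RHS]e; ring.
- by rewrite lift_eqF rmorph0 !mulr0 !mul0r ?addr0.
- by rewrite (negbTE (neq_lift _ _)) rmorph0 !mulr0 !mul0r !addr0.
rewrite eqxx rmorph0 !mulr0 !addr0 rmorphXn /= rmorphN1 -exprMn.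
by rewrite mulrNN mulr1 expr1n.
Qed.

Lemma embed_block_det al ga : `|al| ^+ 2 + `|ga| ^+ 2 = 1 ->
  \det (embed_block al ga) = 1.
Proof.
rewrite !normCK => e; rewrite (expand_det_row _ i) (sum_lift j) big1 => [|m _].
  rewrite addr0 !mxE !unlift_none /cofactor mulrA -exprMn mulrNN mulr1 expr1n mul1r.
  rewrite det2 !mxE !liftK /= -[RHS]e; ring.
by rewrite mxE unlift_none liftK mul0r.
Qed.

Lemma exists_U2 al ga : `|al| ^+ 2 + `|ga| ^+ 2 = 1 ->
  exists2 g : SU3 R, U2 i j g & [/\ SU3mx g (lift i ord0) (lift j ord0) = al,
   SU3mx g (lift i (lift ord0 ord0)) (lift j ord0) = ga & SU3mx g i j = (-1) ^+ (i + j)].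
Proof.
move=> e; have [g gE] := exists_SU3 (embed_block_unitary e) (embed_block_det e).
exists g; last by rewrite gE !mxE !liftK !unlift_none.
apply/U2P => x y; rewrite gE mxE.
by case: (unliftP i x) => [x' ->|->]; case: (unliftP j y) => [y' ->|->]; rewrite ?lift_eqF ?eqxx.
Qed.
End BlockEmbedding.

(** * The quotient of a block by the torus *)

Lemma exists_perm2 (T : finType) (i k j l : T) : i != k -> j != l ->
  exists s : {perm T}, s i = j /\ s k = l.
Proof.
move=> ik jl; exists (tperm i j * tperm (tperm i j k) l)%g; rewrite !permM tpermL.
split; last by rewrite tpermL.
have jk : j != tperm i j k.
  apply: contra ik => /eqP e; rewrite -(inj_eq (@perm_inj _ (tperm i j))) tpermL.
  exact/eqP.
by rewrite tpermD // eq_sym.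
Qed.

Lemma mulr3ACA (K : comNzRingType) (a1 a2 a3 b1 b2 b3 : K) :
  (a1 * b1) * (a2 * b2) * (a3 * b3) = (a1 * a2 * a3) * (b1 * b2 * b3).
Proof. by ring. Qed.

Section Sphere.
Variable R : realType.
Variables (p q : 'rV[int]_3) (hpq : \sum_i p 0 i = \sum_i q 0 i).
Variables (a b : 'rV[int]_3) (hab : \sum_i a 0 i = \sum_i b 0 i).
Local Notation C := R[i].
Local Notation RV := 'rV[R]_(3 * 3 + 3 * 3).
Local Notation cx := of_real_coords.
Implicit Types (g h : SU3 R) (t : S1 R * S1 R) (s : 'S_3).
Hypothesis li : forall s, lin_indep (p - col_perm s q) (a - col_perm s b).
Variables i j : 'I_3.

Let k := lift i ord0.
Let k' := lift i (lift ord0 ord0).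
Let l := lift j ord0.
Let l' := lift j (lift ord0 ord0).

Definition block_weight (u v : 'rV[int]_3) : int * int * int :=
  (u 0 k - v 0 l, u 0 k' - v 0 l, u 0 i - v 0 j).

(** These two components of the cross product are minors of p - q_s and a - b_s
for permutations s that pass through the corner and one entry of the column. *)
Lemma block_cross :
  let c := cross3 (block_weight p q) (block_weight a b) in
  c.1.1 != 0 /\ c.1.2 != 0.
Proof.
have ki : k != i by rewrite /k eq_sym neq_lift.
have k'i : k' != i by rewrite /k' eq_sym neq_lift.
have lj : l != j by rewrite /l eq_sym neq_lift.
split=> /=.
  have [s [sk si]] := exists_perm2 k'i lj.
  by have := minor_neq0 hpq hab (li s) k'i; rewrite /minor !mxE sk si.
have [s [sk si]] := exists_perm2 ki lj.
have := minor_neq0 hpq hab (li s) (x := i) (y := k); rewrite /minor !mxE sk si.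
by apply; rewrite eq_sym.
Qed.

Section Invariant.
Variable n : int * int * int.

(** The invariant monomial of the three coordinates, rescaled to the modulus
|al| |ga| on the block. *)
Definition zeta (A : 'M[C]_3) : C :=
  phase_pow (A k l) n.1.1 * phase_pow (A k' l) n.1.2 * phase_pow (A i j) n.2.

Definition height (A : 'M[C]_3) : R :=
  complex.Re (A k l * (A k l)^*) - complex.Re (A k' l * (A k' l)^*).

(** For n = (1, -1, 0) this is the Hopf map of the column (al, ga). *)
Definition sphere_map (A : 'M[C]_3) : 'rV[R]_3 :=
  \row_m [:: height A; 2 * complex.Re (zeta A); 2 * complex.Im (zeta A)]`_m.

Lemma continuous_sphere_map :
  continuous (fun g : SU3 R => sphere_map (SU3mx g)).
Proof.
have comp (f : RV -> R) (g : SU3 R) : continuous f ->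
    f (real_coords (SU3mx h)) @[h --> g] --> f (real_coords (SU3mx g)).
  by move=> cf; apply: (continuous_comp (@continuous_SU3_coords R g)); exact: cf.
have ce x y (g : SU3 R) : ccvg (fun h : SU3 R => SU3mx h x y) g.
  rewrite (_ : (fun h : SU3 R => _) = fun h => cx (real_coords (SU3mx h)) x y).
    have [/smooth_continuous cr /smooth_continuous ci] := @csmooth_entry R x y.
    by split; [apply: (comp _ _ cr)|apply: (comp _ _ ci)].
  by apply/funext => h; rewrite real_coordsK.
have cz (g : SU3 R) : ccvg (fun h : SU3 R => zeta (SU3mx h)) g.
  apply: ccvgM; last by apply: ccvg_phase_pow; exact: ce.
  by apply: ccvgM; apply: ccvg_phase_pow; exact: ce.
have cn x y (g : SU3 R) : ccvg (fun h : SU3 R => SU3mx h x y * (SU3mx h x y)^*) g.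
  by apply: ccvgM; [|apply: ccvg_conj]; exact: ce.
have ch (g : SU3 R) : height (SU3mx h) @[h --> g] --> height (SU3mx g).
  by exact: (cvgB (cn k l g).1 (cn k' l g).1).
apply: continuous_mx => x m g.
pose c m (h : SU3 R) := [:: height (SU3mx h); 2 * complex.Re (zeta (SU3mx h));
  2 * complex.Im (zeta (SU3mx h))]`_m.
have e h : sphere_map (SU3mx h) x m = c m h by rewrite mxE.
have -> : (fun h : SU3 R => sphere_map (SU3mx h) x m) = c m by exact/funext.
rewrite /continuous_at.
move: m {e}; apply: forall_ord3; first exact: ch.
  by exact: (cvgM (cvg_cst _) (cz g).1).
by exact: (cvgM (cvg_cst _) (cz g).2).
Qed.

Lemma zeta_scale (A B : 'M[C]_3) (r : C * C * C) : circle3 r -> monomial r n = 1 ->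
  B k l = r.1.1 * A k l -> B k' l = r.1.2 * A k' l -> B i j = r.2 * A i j ->
  zeta B = zeta A.
Proof.
move=> [r1 r2 r3] rn e1 e2 e3; by rewrite /zeta e1 e2 e3 !phase_powM // mulr3ACA -[X in X * _]/(monomial r n) rn mul1r.
Qed.

Lemma height_norm (A : 'M[C]_3) : (height A)%:C%C = `|A k l| ^+ 2 - `|A k' l| ^+ 2.
Proof.
rewrite !normCK /height; case: (A k l) (A k' l) => u v [u' v'].
by apply/eqP; rewrite eq_complex /=; apply/andP; split; apply/eqP; ring.
Qed.

Lemma U2_col g : U2 i j g -> `|SU3mx g k l| ^+ 2 + `|SU3mx g k' l| ^+ 2 = 1.
Proof.
move=> gU; have := SU3_cols g l l; rewrite eqxx (sum_lift i) !big_ord_recl big_ord0.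
rewrite ((U2P g i j).1 gU i l) ?eqxx ?lift_eqF // mul0r add0r addr0 -!normCK.
by move=> ->.
Qed.

Lemma U2_corner g : U2 i j g -> `|SU3mx g i j| = 1.
Proof.
move=> gU; have := SU3_rows g i i; rewrite eqxx (sum_lift j) big1 ?addr0 => [|m _].
  by rewrite -normCK => /eqP; rewrite -[true%:R]/1 pexpr_eq1 // => /eqP.
by rewrite ((U2P g i j).1 gU) ?mul0r // eqxx lift_eqF.
Qed.

Lemma norm_zeta g : U2 i j g -> `|zeta (SU3mx g)| = `|SU3mx g k l| * `|SU3mx g k' l|.
Proof. by move=> gU; rewrite /zeta !normrM !norm_phase_pow (U2_corner gU) mulr1. Qed.

Lemma sum_row3 (f : 'I_3 -> R) :
  \sum_m f m = f ord0 + f (lift ord0 ord0) + f (lift ord0 (lift ord0 ord0)).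
Proof. by rewrite !big_ord_recl big_ord0 addr0 addrA. Qed.

Lemma sphere_map_sphere g : U2 i j g -> sphere2 R (sphere_map (SU3mx g)).
Proof.
move=> gU; rewrite /sphere2 /= sum_row3 !mxE /=.
apply: (@complexI R); have col := U2_col gU.
have := congr1 (fun z => z ^+ 2) (norm_zeta gU).
rewrite exprMn [in LHS]normCK; set z := zeta _.
have -> : z * z^* = (complex.Re z ^+ 2 + complex.Im z ^+ 2)%:C%C.
  by case: z => u v; apply/eqP; rewrite eq_complex /=; apply/andP; split; apply/eqP; ring.
move=> e; have hh := height_norm (SU3mx g).
have eC (x u v : R) : (x ^+ 2 + (2 * u) ^+ 2 + (2 * v) ^+ 2)%:C%C =
    x%:C%C ^+ 2 + 4 * (u ^+ 2 + v ^+ 2)%:C%C :> C.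
  by rewrite !expr2 !rmorphD !rmorphM /= rmorph_nat; ring.
rewrite eC hh e -[RHS]/(1 : C) -[RHS](expr1n _ 2) -[X in _ = X ^+ 2]col; ring.
Qed.

(** The sum of the squared moduli is 1 and the height is their difference, so the
height determines both moduli. *)
Lemma sphere_map_eq g h : U2 i j g -> U2 i j h ->
  sphere_map (SU3mx g) = sphere_map (SU3mx h) ->
  [/\ `|SU3mx g k l| = `|SU3mx h k l|, `|SU3mx g k' l| = `|SU3mx h k' l|
    & zeta (SU3mx g) = zeta (SU3mx h)].
Proof.
move=> gU hU /rowP e.
have := e ord0; rewrite !mxE /= => /(congr1 (fun x : R => x%:C%C)).
rewrite !height_norm => eh.
have cg := U2_col gU; have ch := U2_col hU.
have two : (2 : C) != 0 by rewrite pnatr_eq0.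
have sqr_inj (u v : C) : 0 <= u -> 0 <= v -> u ^+ 2 = v ^+ 2 -> u = v.
  by move=> u0 v0 /eqP; rewrite eqrXn2 // => /eqP.
split.
- apply: sqr_inj => //; apply: (mulfI two).
  transitivity (1 + (`|SU3mx g k l| ^+ 2 - `|SU3mx g k' l| ^+ 2)); first by rewrite -[X in _ = X + _]cg; ring.
  by rewrite eh -[X in X + _ = _]ch; ring.
- apply: sqr_inj => //; apply: (mulfI two).
  transitivity (1 - (`|SU3mx g k l| ^+ 2 - `|SU3mx g k' l| ^+ 2)); first by rewrite -[X in _ = X + _]cg; ring.
  by rewrite eh -[X in X + _ = _]ch; ring.
have := e (lift ord0 ord0); have := e (lift ord0 (lift ord0 ord0)); rewrite !mxE /=.
have two' : (2 : R) != 0 by rewrite pnatr_eq0.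
move=> /(mulfI two') e2 /(mulfI two') e1.
by apply/eqP; rewrite eq_complex e1 e2 !eqxx.
Qed.

(** When both coordinates of the column are nonzero, the phases are determined
and the equality of the invariants says that the monomial is 1 on them.  When
one coordinate vanishes its phase is free, and is used to solve the monomial
equation; this needs the corresponding exponent to be nonzero. *)
Lemma fibre_phase g h : n.1.1 != 0 -> n.1.2 != 0 -> U2 i j g -> U2 i j h ->
  sphere_map (SU3mx g) = sphere_map (SU3mx h) ->
  exists r, [/\ circle3 r, monomial r n = 1, SU3mx h k l = r.1.1 * SU3mx g k l,
    SU3mx h k' l = r.1.2 * SU3mx g k' l & SU3mx h i j = r.2 * SU3mx g i j].
Proof.
move=> n1 n2 gU hU e; have [e1 e2 ez] := sphere_map_eq gU hU e.
have [s1 [s11 h1]] := norm_eq_phase e1; have [s2 [s21 h2]] := norm_eq_phase e2.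
have [s3 [s31 h3]] := norm_eq_phase (etrans (U2_corner gU) (esym (U2_corner hU))).
have solve m c : m != 0 -> `|c| = 1 -> exists u : C, `|u| = 1 /\ u ^ m * c = 1.
  move=> m0 c1; have [|u [u1 uE]] := @unit_root _ c^-1 m m0; first by rewrite normfV c1 invr1.
  by exists u; rewrite uE mulVf ?norm1_neq0.
have [g1|g1] := eqVneq (SU3mx g k l) 0.
  have [|u [u1 uE]] := @solve n.1.1 (s2 ^ n.1.2 * s3 ^ n.2) n1.
    by rewrite normrM !norm1_exp // mulr1.
  exists (u, s2, s3); split; [by split|by rewrite /monomial /= -mulrA| |exact: h2|exact: h3].
  by rewrite h1 g1 !mulr0.
have [g2|g2] := eqVneq (SU3mx g k' l) 0.
  have [|u [u1 uE]] := @solve n.1.2 (s1 ^ n.1.1 * s3 ^ n.2) n2.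
    by rewrite normrM !norm1_exp // mulr1.
  exists (s1, u, s3); split; [by split| |exact: h1| |exact: h3].
    by rewrite /monomial /= -mulrA mulrCA.
  by rewrite h2 g2 !mulr0.
exists (s1, s2, s3); split; [by split| |exact: h1|exact: h2|exact: h3].
have z0 : zeta (SU3mx g) != 0 by rewrite -normr_eq0 norm_zeta // mulf_neq0 ?normr_eq0.
apply: (mulIf z0); rewrite mul1r [RHS]ez /zeta h1 h2 h3 !phase_powM // mulr3ACA.
by [].
Qed.

(** Take ga real, the corner a sign, and give al a phase whose n1-th power is the
required phase, corrected by the contribution of the corner. *)
Lemma sphere_map_surjective v : n.1.1 != 0 -> sphere2 R v ->
  exists2 g, U2 i j g & sphere_map (SU3mx g) = v.
Proof.
move=> n1; rewrite /sphere2 /= sum_row3.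
set c := v 0 ord0; set x := v 0 _; set y := v 0 _ => sph.
have cc : c ^+ 2 <= 1 by rewrite -sph -addrA lerDl addr_ge0 ?sqr_ge0.
have c1 : -1 <= c <= 1 by rewrite -ler_norml -(@expr_le1 _ 2) // real_normK ?num_real.
(* the moduli of al and ga at height c *)
pose ra := Num.sqrt ((1 + c) / 2); pose rb := Num.sqrt ((1 - c) / 2).
have raE : ra ^+ 2 = (1 + c) / 2 by rewrite sqr_sqrtr //; lra.
have rbE : rb ^+ 2 = (1 - c) / 2 by rewrite sqr_sqrtr //; lra.
have ra0 : 0 <= ra by exact: sqrtr_ge0.
have rb0 : 0 <= rb by exact: sqrtr_ge0.
have raC : 0 <= ra%:C%C :> C by rewrite lecR.
have rbC : 0 <= rb%:C%C :> C by rewrite lecR.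
have normR (w : R) : 0 <= w -> `|w%:C%C| = w%:C%C :> C by move=> w0; rewrite ger0_norm // lecR.
pose Z : C := (x / 2 +i* (y / 2))%C.
have nZ : `|(ra * rb)%:C%C| = `|Z|.
  rewrite normR ?mulr_ge0 // normc_def; congr (_%:C)%C.
  apply/eqP; rewrite -(@eqrXn2 _ 2) ?mulr_ge0 ?sqrtr_ge0 // sqr_sqrtr ?addr_ge0 ?sqr_ge0 //.
  by apply/eqP; rewrite exprMn raE rbE /=; lra.
have [tau [tau1 ZE]] := norm_eq_phase nZ.
pose eps : C := (-1) ^+ (i + j).
have eps1 : `|eps| = 1 by rewrite normrX normrN1 expr1n.
have [|om [om1 omE]] := @unit_root _ (tau * phase_pow eps (- n.2)) _ n1.
  by rewrite normrM tau1 norm_phase_pow eps1 mulr1.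
have sum1 : `|om * ra%:C%C| ^+ 2 + `|rb%:C%C| ^+ 2 = 1 :> C.
  rewrite normrM om1 mul1r !normR // -!rmorphXn /= -rmorphD raE rbE.
  by rewrite -(rmorph1 (real_complex R)); congr (_%:C)%C; lra.
have [g gU [g1 g2 g3]] := exists_U2 i j sum1; exists g => //.
have zE : zeta (SU3mx g) = Z.
  have pe : phase_pow eps (- n.2) * phase_pow eps n.2 = 1.
    rewrite -[eps]mulr1 !phase_powM // !phase_pow_ge0 // !mulr1 -expfzDr ?norm1_neq0 //.
    by rewrite addNr expr0z.
  rewrite /zeta g1 g2 g3 phase_powM // omE [phase_pow ra%:C%C _]phase_pow_ge0 //.
  rewrite [phase_pow rb%:C%C _]phase_pow_ge0 // ZE rmorphM /=.
  by rewrite -[RHS]mulr1 -[X in _ = _ * X]pe -/eps; move: (phase_pow eps _) (phase_pow eps _) => e1 e2; ring.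
have hE : height (SU3mx g) = c.
  apply: (@complexI R); rewrite height_norm g1 g2 normrM om1 mul1r !normR // -!rmorphXn /=.
  by rewrite -rmorphB raE rbE; congr (_%:C)%C; lra.
apply/rowP; apply: forall_ord3; rewrite mxE /= ?hE ?zE //=.
- by rewrite mulrC divfK ?pnatr_eq0.
- by rewrite mulrC divfK ?pnatr_eq0.
Qed.

End Invariant.

Section Primitive.
Variables (d : int) (n r : int * int * int).
Hypothesis d0 : d != 0.
Hypothesis cE : cross3 (block_weight p q) (block_weight a b) = scale3 d n.
Hypothesis rn : dot3 r n = 1.

Lemma primitive_n0 : n.1.1 != 0 /\ n.1.2 != 0.
Proof.
have [c1 c2] := block_cross; rewrite cE in c1 c2.
by split; [apply: contraNneq c1|apply: contraNneq c2] => /= ->; rewrite mulr0.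
Qed.

(** The vector n is proportional to the cross product of the weight vectors, hence
orthogonal to both of them. *)
Lemma weight_monomial t :
  monomial (weight p q a b t k l, weight p q a b t k' l, weight p q a b t i j) n = 1.
Proof.
have dn1 : dot3 (block_weight p q) n = 0.
  apply: (mulfI d0); rewrite mulr0; transitivity (dot3 (block_weight p q) (scale3 d n)).
    by rewrite /dot3 /=; ring.
  by rewrite -cE /dot3 /=; ring.
have dn2 : dot3 (block_weight a b) n = 0.
  apply: (mulfI d0); rewrite mulr0; transitivity (dot3 (block_weight a b) (scale3 d n)).
    by rewrite /dot3 /=; ring.
  by rewrite -cE /dot3 /=; ring.
rewrite (monomial_characters (block_weight p q) (block_weight a b)) ?S1_neq0 //.
by rewrite dn1 dn2 !expr0z mulr1.
Qed.

Lemma sphere_map_T2act t g :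
  sphere_map n (SU3mx (T2act hpq hab t g)) = sphere_map n (SU3mx g).
Proof.
pose w x y := weight p q a b t x y.
have zE : zeta n (SU3mx (T2act hpq hab t g)) = zeta n (SU3mx g).
  apply: (@zeta_scale n _ _ (w k l, w k' l, w i j)); rewrite ?T2act_entry //.
    by split; exact: norm_weight.
  exact: weight_monomial.
have hE : height (SU3mx (T2act hpq hab t g)) = height (SU3mx g).
  by apply: (@complexI R); rewrite !height_norm !T2act_entry (normrM (weight p q a b t k l))
    (normrM (weight p q a b t k' l)) !norm_weight !mul1r.
by apply/rowP => m; rewrite !mxE zE hE.
Qed.

(** [torus_image] turns the phases into an element of T^2 that matches the column
and the corner; the second column of the 2 x 2 part is then determined by
cofactors. *)
Lemma sphere_map_orbit g h : U2 i j g -> U2 i j h ->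
  sphere_map n (SU3mx g) = sphere_map n (SU3mx h) -> exists t, h = T2act hpq hab t g.
Proof.
move=> gU hU e; have [n1 n2] := primitive_n0.
have [s [cs sn h1 h2 h3]] := fibre_phase n1 n2 gU hU e.
have [z [w [z1 w1 sE]]] := torus_image d0 cE rn cs sn.
pose t : S1 R * S1 R := (SigSub (S1_mem z1), SigSub (S1_mem w1)).
exists t; have tU : U2 i j (T2act hpq hab t g) by exact: U2_T2act.
have e1 : SU3mx h k l = SU3mx (T2act hpq hab t g) k l by rewrite T2act_entry h1 sE.
have e2 : SU3mx h k' l = SU3mx (T2act hpq hab t g) k' l by rewrite T2act_entry h2 sE.
have e3 : SU3mx h i j = SU3mx (T2act hpq hab t g) i j by rewrite T2act_entry h3 sE.
have e0 x y : (x == i) != (y == j) -> SU3mx h x y = SU3mx (T2act hpq hab t g) x y.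
  by move=> xy; rewrite ((U2P h i j).1 hU) // ((U2P _ i j).1 tU).
have lift2 (m : 'I_3) (P : 'I_3 -> Prop) : P m -> P (lift m ord0) ->
    P (lift m (lift ord0 ord0)) -> forall x, P x.
  move=> P0 P1 P2 x; case: (unliftP m x) => [[[|[|//]] hx] ->|-> //].
    by rewrite (_ : Ordinal hx = ord0) //; exact: val_inj.
  by rewrite (_ : Ordinal hx = lift ord0 ord0) //; exact: val_inj.
have kk' : k != k' by rewrite (inj_eq lift_inj).
have ll' : l != l' by rewrite (inj_eq lift_inj).
have e4 : SU3mx h k l' = SU3mx (T2act hpq hab t g) k l'.
  apply: SU3_entry_determined; apply: (lift2 i); apply: (lift2 j) => xk yl;
  first [exact: e1|exact: e2|exact: e3|by case/eqP: xk|by case/eqP: yl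
        |by apply: e0; rewrite ?eqxx ?lift_eqF].
have e5 : SU3mx h k' l' = SU3mx (T2act hpq hab t g) k' l'.
  apply: SU3_entry_determined; apply: (lift2 i); apply: (lift2 j) => xk yl;
  first [exact: e1|exact: e2|exact: e3|by case/eqP: xk|by case/eqP: yl
        |by apply: e0; rewrite ?eqxx ?lift_eqF].
apply: SU3_inj; apply/matrixP; apply: (lift2 i); apply: (lift2 j) => //;
 by apply: e0; rewrite ?eqxx ?lift_eqF.
Qed.
End Primitive.
End Sphere.

(** * The theorem *)

(** The map g is the inverse of a continuous bijection onto B, and V the image of
the compact set of points lying over K.  The Hausdorff property is asked of U
only, T being a quotient space in the application. *)
Lemma compact_bijection_inverse_continuous (T U : topologicalType) (B : set U)
    (g : U -> T) : hausdorff_space U ->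
  (forall K : set T, closed K -> exists2 V : set U, compact V &
     forall v, B v -> V v <-> K (g v)) ->
  {within B, continuous g}.
Proof.
move=> hU h; apply/continuous_closedP => K /h[V cV VE].
apply/closed_subspaceP; exists V; first exact: compact_closed.
by apply/seteqP; split=> v [hv Bv]; split=> //; exact/(VE v Bv).
Qed.

Section Homeo.
Variable R : realType.
Variables (p q : 'rV[int]_3) (hpq : \sum_i p 0 i = \sum_i q 0 i).
Variables (a b : 'rV[int]_3) (hab : \sum_i a 0 i = \sum_i b 0 i).
Hypothesis li : forall s : 'S_3, lin_indep (p - col_perm s q) (a - col_perm s b).
Local Notation pt g := (hatpi hab (Epi hpq g)).

(** The sphere map is invariant on the whole of SU(3), so it descends to a
continuous function on the whole orbit space; only its bijectivity from the
image of the block to the sphere uses the block. *)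
Lemma hatL_homeomorphic i j : homeomorphic (hatL R hpq hab i j) (sphere2 R).
Proof.
have [c1 _] := block_cross hpq hab li i j.
have [|d [n [r [d0 cE rn]]]] := @primitive_vector (cross3 (block_weight i j p q) (block_weight i j a b)).
  by apply: contra_neq c1 => ->.
have [n1 _] := primitive_n0 hpq hab li cE.
pose Phi (g : SU3 R) := sphere_map i j n (SU3mx g).
pose f (x : Oquot R hpq hab) := Phi (repr (repr x)).
have fE g : f (pt g) = Phi g.
  have : hatpi hab (Epi hpq (repr (repr (pt g)))) = pt g by rewrite /Epi reprK /hatpi reprK.
  by move=> /esym/hatpi_eq[t e]; rewrite /f e; exact: (sphere_map_T2act hpq hab d0 cE).
have cf : continuous f.
  apply/quotient_continuous; apply/quotient_continuous.
  rewrite (_ : _ \o _ = Phi); first exact: continuous_sphere_map.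
  by apply/funext => g; exact: fE.
have surj v : exists x, sphere2 R v -> hatL R hpq hab i j x /\ f x = v.
  have [sv|nv] := pselect (sphere2 R v).
    have [g gU gv] := sphere_map_surjective i j n1 sv.
    by exists (pt g) => _; rewrite fE; split=> //; apply/hatLP.
  by have [g _] := T2sub_neq0 R 1%g; exists (pt g).
have [g gP] := choice surj; exists f, g; split.
- exact: continuous_subspaceT.
- apply: compact_bijection_inverse_continuous; first exact: norm_hausdorff.
  move=> K cK; exists (Phi @` (((fun h => pt h) @^-1` K) `&` U2 i j)).
    apply: continuous_compact; first by apply: continuous_subspaceT; exact: continuous_sphere_map.
    rewrite setIC; apply: compact_closedI; first exact: compact_U2.
    have cpi : continuous (fun h : SU3 R => pt h).
      have c1' : continuous (Epi hpq : SU3 R -> _) by exact: pi_continuous.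
      have c2' : continuous (@hatpi R p q hpq a b hab) by exact: pi_continuous.
      by move=> h; apply: (continuous_comp (c1' h)); exact: c2'.
    by move/continuous_closedP: cpi; apply.
  move=> v sv; have [] := gP v sv; have [h ->] := OquotP (g v).
  rewrite fE => /hatLP hU hv; split=> [[h' [Kh' hU'] e]|Kh].
    have [t ->] := sphere_map_orbit hpq hab li d0 cE rn hU' hU (etrans e (esym hv)).
    have -> : pt (T2act hpq hab t h') = pt h' by apply/esym/hatpi_eq; exists t.
    exact: Kh'.
  by exists h.
- move=> x; have [h ->] := OquotP x => /hatLP hU; rewrite fE.
  have sh : sphere2 R (Phi h) by exact: sphere_map_sphere.
  split=> //; have [] := gP _ sh; have [h' ->] := OquotP (g (Phi h)).
  rewrite fE => /hatLP hU' e; apply/hatpi_eq.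
  exact: (sphere_map_orbit hpq hab li d0 cE rn hU' hU e).
- by move=> v sv; have [] := gP v sv.
Qed.
End Homeo.

Theorem theoremA (R : realType) (p q a b : 'rV[int]_3)
    (hpq : \sum_i p 0 i = \sum_i q 0 i)
    (hp : forall s : 'S_3, p - col_perm s q != 0)
    (hab : \sum_i a 0 i = \sum_i b 0 i) :
  (E_almost_free R hpq hab <->
    forall s : 'S_3, lin_indep (p - col_perm s q) (a - col_perm s b)) /\
  (E_almost_free R hpq hab ->
    [/\ quotient_orbifold R hpq hab 6 [set: SU3 R],
        exists (G : {set 'I_3 * 'I_3}) (S : {set 'S_3}),
          singular_locus R hpq hab =
            \bigcup_(ij in [set` G]) hatL R hpq hab ij.1 ij.2 `|`
            \bigcup_(s in [set` S]) hatC R hpq hab s,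
        forall i j : 'I_3, hatL_orbifold_sphere R hpq hab i j,
        (forall s : 'S_3, exists x, hatC R hpq hab s = [set x]) /\
        injective (hatC R hpq hab)
      & [/\ forall (i j : 'I_3) (s : 'S_3),
              hatC R hpq hab s `<=` hatL R hpq hab i j <-> s i = j,
            forall i j : 'I_3, #|[set s : 'S_3 | s i == j]%SET| = 2%N
          & forall i j k l : 'I_3, (i, j) <> (k, l) ->
              hatL R hpq hab i j `&` hatL R hpq hab k l =
              \bigcup_(s in [set s : 'S_3 | s i = j /\ s k = l])
                hatC R hpq hab s]]).
Proof.
have free_li : E_almost_free R hpq hab ->
    forall s : 'S_3, lin_indep (p - col_perm s q) (a - col_perm s b).
  by move=> af s; exact: almost_free_lin_indep (hp s) af.
split; first by split=> // li; exact: lin_indep_almost_free.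
move=> /free_li li; split.
- split=> [|t g _|g _] //; first exact: SU3_submanifold.
  exact: T2_isotropy_finite.
- exact: singular_locus_union.
- move=> i j; split; last exact: hatL_homeomorphic.
  split=> [|t g|g _]; [exact: U2_submanifold|exact: U2_T2act|].
  exact: T2_isotropy_finite.
- split=> [s|]; [exact: hatC_point|exact: hatC_inj].
- split=> [i j s|i j|i j k l ne].
  + exact: hatC_sub_hatL.
  + exact: card_perm_eq.
  + exact: hatL_meet.
Qed.
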